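(* Let $(M,g)$ be a compact Riemannian manifold with no boundary. There exists a positive constant $C$ such that for any positive smooth function $u\colon M\to \mathbb{R}$ the following inequality holds: $$\int_M |\nabla^2 \sqrt{u}|^2\;\mathrm{dVol}_g\leq C \int_M u\,|\nabla^2 \log u|^2\;\mathrm{dVol}_g,$$ where $\nabla$ is the covariant derivative and $\mathrm{dVol}_g$ is the volume form on $M$.
   Context: The constant $C$ may depend on $(M,g)$ but not on $u$. Here $\log$ is the natural logarithm and $\mathrm{dVol}_g$ is the Riemannian volume form of $g$. For a smooth function $f\colon M\to\mathbb{R}$, the gradient $\nabla f$ is the vector field defined by $g(\nabla f,\cdot)=df$, and the Hessian $\nabla^2 f\colon TM\to TM$ is the endomorphism $X\mapsto \nabla^{LC}_X(\nabla f)$, where $\nabla^{LC}$ is the Levi-Civita connection of $g$. For an endomorphism $A\colon TM\to TM$, $|A|^2=\operatorname{tr}(g^{-1}\circ A^*\circ g\circ A)$, where $g$ is regarded as a map $TM\to T^*M$ and $A^*\colon T^*M\to T^*M$ is the dual map; in an orthonormal frame this is the squared Frobenius norm $\operatorname{tr}(A^TA)$ of the matrix of $A$. *)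

(* Defs.v *)
From HB Require Import structures.
From mathcomp Require Import all_boot all_order all_algebra.
From mathcomp Require Import all_classical all_reals all_analysis.
From mathcomp Require Import ring.

Set Implicit Arguments.
Unset Strict Implicit.
Unset Printing Implicit Defensive.
Import Order.TTheory GRing.Theory Num.Theory.
Import numFieldNormedType.Exports.
Local Open Scope classical_set_scope.
Local Open Scope ring_scope.

Section lebesgue_tuple.
Context {R : realType}.
Local Open Scope ereal_scope.
Local Notation RT := (measurableTypeR R).

Definition tuple_cons n (p : RT * n.-tuple RT) : n.+1.-tuple RT :=
  [the n.+1.-tuple RT of p.1 :: p.2].

Definition tuple_uncons n (t : n.+1.-tuple RT) : RT * n.-tuple RT :=
  (tnth t ord0, [tuple of behead t]).

Lemma measurable_tuple_cons n : measurable_fun setT (@tuple_cons n).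
Proof. exact: measurable_cons. Qed.

Lemma measurable_tuple_uncons n : measurable_fun setT (@tuple_uncons n).
Proof.
by apply/measurable_fun_pair; [exact: measurable_tnth|exact: measurable_behead].
Qed.

Lemma tuple_consK n : cancel (@tuple_cons n) (@tuple_uncons n).
Proof. by move=> [x t]; congr pair; exact/val_inj. Qed.

Section cons_measure.
Context {n : nat} (m : {sigma_finite_measure set (n.-tuple RT) -> \bar R}).

Definition cons_measure : set (n.+1.-tuple RT) -> \bar R :=
  pushforward ((@lebesgue_measure R) \x m) (@tuple_cons n).

Let mcons := @measurable_tuple_cons n.

Let cons_measure0 : cons_measure set0 = 0.
Proof. by rewrite /cons_measure /pushforward preimage_set0 measure0. Qed.

Let cons_measure_ge0 A : 0 <= cons_measure A.
Proof. exact: measure_ge0. Qed.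

Let cons_measure_sigma_additive : semi_sigma_additive cons_measure.
Proof. exact: (@measure_semi_sigma_additive _ _ _ (pushforward _ _)). Qed.

HB.instance Definition _ := isMeasure.Build _ _ _ cons_measure
  cons_measure0 cons_measure_ge0 cons_measure_sigma_additive.

Let cons_measure_sigma_finite : sigma_finite setT cons_measure.
Proof.
have /sigma_finiteP[F [TF ndF Foo]] := sigma_finiteT (@lebesgue_measure R).
have /sigma_finiteP[G [TG ndG Goo]] := sigma_finiteT m.
exists (fun k => @tuple_uncons n @^-1` (F k `*` G k)) => [|k].
  rewrite -preimage_bigcup (_ : \bigcup_k _ = setT) ?preimage_setT//.
  rewrite -setXTT TF TG; apply/seteqP; split => -[x y] /=.
    by case=> k _ [? ?]; split; exists k.
  move=> [[k _ Fkx] [l _ Gly]]; exists (maxn k l) => //; split => /=.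
  - by move: x Fkx; exact/subsetPset/ndF/leq_maxl.
  - by move: y Gly; exact/subsetPset/ndG/leq_maxr.
have [mF Fk] := Foo k; have [mG Gk] := Goo k; split.
  rewrite -[X in measurable X]setTI; apply: measurable_tuple_uncons => //.
  exact: measurableX.
rewrite /cons_measure /pushforward -comp_preimage.
rewrite (_ : _ \o _ = id); last by apply/funext => p; exact: tuple_consK.
by rewrite preimage_id product_measure1E// lte_mul_pinfty// ge0_fin_numE.
Qed.

HB.instance Definition _ := Measure_isSigmaFinite.Build _ _ _ cons_measure
  cons_measure_sigma_finite.

End cons_measure.

Definition unit_measure : set (0.-tuple RT) -> \bar R := \d_[tuple].

HB.instance Definition _ := Measure.on unit_measure.

Let unit_measure_sigma_finite : sigma_finite setT unit_measure.
Proof.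
exists (fun=> setT) => [|_]; first by rewrite bigcup_const//; exists 0%N.
by split; [exact: measurableT|rewrite /unit_measure diracT ltry].
Qed.

HB.instance Definition _ := Measure_isSigmaFinite.Build _ _ _ unit_measure
  unit_measure_sigma_finite.

Fixpoint lebesgue_tuple n : {sigma_finite_measure set (n.-tuple RT) -> \bar R} :=
  match n with
  | 0 => unit_measure
  | k.+1 => cons_measure (lebesgue_tuple k)
  end.

End lebesgue_tuple.

Section local_calculus.
Context {R : realType} {n : nat}.
Implicit Types (D : set 'rV[R]_n) (x : 'rV[R]_n).

Definition partial (j : 'I_n) {W : normedModType R} (f : 'rV[R]_n -> W) :
  'rV[R]_n -> W := 'D_(delta_mx 0 j) f.

(* C^infty on D, meant for open D: all iterated partial derivatives are Frechet
   differentiable, hence also continuous, at every point of D *)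
Definition smooth_on {W : normedModType R} D (f : 'rV[R]_n -> W) : Prop :=
  forall (js : seq 'I_n) x, D x ->
    differentiable (foldr (fun j h => partial j h) f js) x.

(* G is the Gram matrix of a metric in a coordinate system. Tangent vectors are
   row vectors of components, and an endomorphism with matrix H acts on them by
   X |-> X *m H. *)
Variable G : 'rV[R]_n -> 'M[R]_n.

(* Gamma^k_{ij} *)
Definition christoffel (k i j : 'I_n) x : R :=
  2^-1 * \sum_l invmx (G x) k l *
    (partial i (fun y => G y j l) x + partial j (fun y => G y i l) x
     - partial l (fun y => G y i j) x).

(* row i holds the components of the covariant derivative of X along the i-th
   coordinate vector field, so this is the endomorphism Y |-> nabla_Y X *)
Definition covariant_derivative (X : 'rV[R]_n -> 'rV[R]_n) x : 'M[R]_n :=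
  \matrix_(i, k) (partial i (fun y => X y 0 k) x
                  + \sum_j christoffel k i j x * X x 0 j).

Definition differential (f : 'rV[R]_n -> R) x : 'rV[R]_n :=
  \row_j partial j f x.

Definition gradient (f : 'rV[R]_n -> R) x : 'rV[R]_n :=
  differential f x *m invmx (G x).

Definition hessian (f : 'rV[R]_n -> R) : 'rV[R]_n -> 'M[R]_n :=
  covariant_derivative (gradient f).

(* tr (g^-1 o H^* o g o H), composed from left to right because maps act on
   row vectors *)
Definition endo_sqnorm x (H : 'M[R]_n) : R :=
  \tr (H *m G x *m H^T *m invmx (G x)).

Lemma gradientP (f : 'rV[R]_n -> R) x (v : 'rV[R]_n) :
  G x \in unitmx -> gradient f x *m G x *m v^T = differential f x *m v^T.
Proof. by move=> Gu; rewrite /gradient mulmxKV. Qed.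

Let partial_gram_sym x i j k : (\near x, (G x)^T = G x) ->
  partial k (fun y => G y i j) x = partial k (fun y => G y j i) x.
Proof.
move=> Gs; apply: near_eq_derive.
by apply: filterS Gs => y {1}<-; rewrite mxE.
Qed.

(* The next two lemmas say that the connection with symbols christoffel is
   torsion-free and metric, i.e. that it is the Levi-Civita connection. *)
Lemma christoffelC x i j k : (\near x, (G x)^T = G x) ->
  christoffel k i j x = christoffel k j i x.
Proof.
move=> Gs; rewrite /christoffel; congr (_ * _); apply: eq_bigr => l _.
by rewrite (partial_gram_sym i j l Gs) (addrC (partial i _ x)).
Qed.

Lemma christoffel_metric x i j k :
  (\near x, (G x)^T = G x) -> G x \in unitmx ->
  partial k (fun y => G y i j) x =
  \sum_l (christoffel l k i x * G x l j + christoffel l k j x * G x i l).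
Proof.
move=> Gs Gu; have Gsx : (G x)^T = G x by exact: nbhs_singleton Gs.
have GE a b : G x a b = G x b a by rewrite -{1}Gsx mxE.
have lower a b : \sum_l christoffel l k a x * G x l b =
    2^-1 * (partial k (fun y => G y a b) x + partial a (fun y => G y k b) x
            - partial b (fun y => G y k a) x).
  pose T l := partial k (fun y => G y a l) x + partial a (fun y => G y k l) x
            - partial l (fun y => G y k a) x.
  transitivity (2^-1 * \sum_m T m * (G x *m invmx (G x)) b m).
    rewrite mulr_sumr; under eq_bigr do rewrite /christoffel mulr_sumr mulr_suml.
    rewrite exchange_big; apply: eq_bigr => m _ /=.
    rewrite mxE !mulr_sumr; apply: eq_bigr => l _.
    by rewrite (GE l b) /T; ring.
  rewrite mulmxV// (bigD1 b)//= mxE eqxx big1 ?addr0 ?mulr1// => m mb.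
  by rewrite mxE eq_sym (negbTE mb) mulr0.
rewrite big_split /= lower.
under [X in _ = _ + X]eq_bigr do rewrite GE.
rewrite lower (partial_gram_sym j i k Gs) (partial_gram_sym k i j Gs).
rewrite (partial_gram_sym k j i Gs).
rewrite -mulrDr -[LHS](mulKf (_ : 2 != 0 :> R)) ?pnatr_eq0//.
by congr (_ * _); ring.
Qed.

End local_calculus.

Section manifold.
Context {R : realType} (n : nat) (M : topologicalType).

Record chart := Chart {
  dom : set M;
  cod : set 'rV[R]_n;
  coord : M -> 'rV[R]_n;
  param : 'rV[R]_n -> M;
  open_dom : open dom;
  open_cod : open cod;
  coord_cod : forall p, dom p -> cod (coord p);
  param_dom : forall x, cod x -> dom (param x);
  coordK : forall p, dom p -> param (coord p) = p;
  paramK : forall x, cod x -> coord (param x) = x;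
  continuous_coord : {within dom, continuous coord};
  continuous_param : {within cod, continuous param}
}.

Definition transition (c c' : chart) : 'rV[R]_n -> 'rV[R]_n :=
  coord c' \o param c.

Record smooth_atlas := SmoothAtlas {
  index : Type;
  atlas_chart :> index -> chart;
  atlas_cover : forall p, exists i, dom (atlas_chart i) p;
  smooth_transition : forall i j,
    smooth_on (cod (atlas_chart i) `&`
               param (atlas_chart i) @^-1` dom (atlas_chart j))
      (transition (atlas_chart i) (atlas_chart j))
}.

Variable A : smooth_atlas.

Definition index_at (p : M) : index A := sval (cid (atlas_cover A p)).

Lemma dom_index_at p : dom (A (index_at p)) p.
Proof. exact: (svalP (cid (atlas_cover A p))). Qed.

Definition smooth (u : M -> R) : Prop :=
  forall i, smooth_on (cod (A i)) (u \o param (A i)).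

Record riemannian_metric := RiemannianMetric {
  gram :> index A -> 'rV[R]_n -> 'M[R]_n;
  smooth_gram : forall i a b, smooth_on (cod (A i)) (fun x => gram i x a b);
  gram_sym : forall i x, cod (A i) x -> (gram i x)^T = gram i x;
  gram_gt0 : forall i x (v : 'rV[R]_n), cod (A i) x -> v != 0 ->
    0 < (v *m gram i x *m v^T) 0 0;
  gram_transition : forall i j x, cod (A i) x -> dom (A j) (param (A i) x) ->
    let tau := transition (A i) (A j) in
    gram i x = 'J tau x *m gram j (tau x) *m ('J tau x)^T
}.

Variable g : riemannian_metric.

Lemma gram_unit i x : cod (A i) x -> g i x \in unitmx.
Proof.
move=> xc; rewrite -row_free_unit -kermx_eq0.
apply/eqP/row_matrixP => k; rewrite row0.
apply/eqP; apply: contraT => kn0.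
have := gram_gt0 g xc kn0; rewrite -row_mul.
by rewrite mulmx_ker row0 mul0mx mxE ltxx.
Qed.

(* the squared norm of the Hessian of f at p, computed in a chart around p; as
   the Hessian is a tensor, the choice of the chart is immaterial *)
Definition hessian_sqnorm (f : M -> R) (p : M) : R :=
  let i := index_at p in let x := coord (A i) p in
  endo_sqnorm (g i) x (hessian (g i) (f \o param (A i)) x).

End manifold.

(* mu is dVol_g: in each chart it has density sqrt (det g) with respect to
   Lebesgue measure, which determines mu uniquely when the atlas has a
   countable subcover *)
Definition is_riemannian_volume {R : realType} {n : nat} {M : ptopologicalType}
    {A : smooth_atlas n M} (g : riemannian_metric A)
    (mu : {measure set (g_sigma_algebraType (@open M)) -> \bar R}) : Prop :=
  forall (i : index A) (B : set M),
    (@open M).-sigma.-measurable B -> B `<=` dom (A i) ->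
    mu B = (\int[lebesgue_tuple n]_(t in
              [set t | cod (A i) (\row_j tnth t j) /\
                       B (param (A i) (\row_j tnth t j))])
              (Num.sqrt (\det (g i (\row_j tnth t j))))%:E)%E.

(* Main.v *)
Require Import Defs.
From mathcomp Require Import all_boot all_order all_algebra.
From mathcomp Require Import all_classical all_reals all_analysis.
From mathcomp Require Import perm measurable_realfun.
From mathcomp Require Import ring lra.

Set Implicit Arguments.
Unset Strict Implicit.
Unset Printing Implicit Defensive.
Import Order.TTheory GRing.Theory Num.Theory.
Import numFieldNormedType.Exports.
Local Open Scope classical_set_scope.
Local Open Scope ring_scope.
Import Defs.

(* Write phi = log u, X = grad phi, N = |X|^2 and H for the Hessian of phi. Since
   sqrt u = exp (phi / 2), its Hessian is (sqrt u / 2) (H + X^* (x) X / 2), so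
   its squared norm is at most u |H|^2 / 2 + u N^2 / 8. It remains to bound the
   integral of u N^2. The vector field u N X has divergence
   u (N^2 + 2 g(H X, X) + N tr H) >= u (N^2 / 2 - (n + 4) |H|^2),
   and the integral of a divergence vanishes, hence
   int u N^2 <= 2 (n + 4) int u |H|^2.
   The divergence theorem is only needed for fields supported in one chart: the
   field is multiplied by the functions a_p of a C^1 partition of unity, and the
   terms u N g(X, grad a_p) this produces add up to zero. *)

(** * Positive definite matrices *)

(** The field u N X is chosen because du = u dphi: the derivative of u along X is u N, which
    produces the wanted u N^2, while differentiating N and X leaves terms linear in H, which Young's
    inequality absorbs at the price of half of N^2. Inserting the estimate for u N^2 with its weight
    1/8 gives the constant 1/2 + (n + 4)/4. The obstacle is that the integrands are computed at each
    point in a chart picked by [index_at], so no chart integral is available before the Hessian norm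
    is known to be independent of the chart. The transformation rule of Christoffel symbols is
    avoided: the Hessian is evaluated on gradients only, where it is expressed through the form (f,
    h) |-> g(grad f, grad h). Regularity is counted to finite order: cut-off functions and metric
    are differentiated once, u twice. The measure is known only on Borel sets inside a chart, so
    integrals of functions, and even the finiteness of the total volume, have to be recovered from
    there. *)

Lemma mulmx1_invmx (R : comUnitRingType) n (A B : 'M[R]_n) :
  A *m B = 1%:M -> invmx A = B.
Proof. by move=> AB; have [Au _] := mulmx1_unit AB; rewrite -[RHS](mulKmx Au) AB mulmx1. Qed.

Lemma invmx_mulmx (R : comUnitRingType) n (A B : 'M[R]_n) :
  A \in unitmx -> B \in unitmx -> invmx (A *m B) = invmx B *m invmx A.
Proof.
move=> Au Bu; apply: mulmx1_invmx.
by rewrite mulmxA mulmxK// mulmxV.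
Qed.

Section positive_definite.
Context {R : rcfType}.

Definition posdef n (G : 'M[R]_n) : Prop :=
  G^T = G /\ forall v : 'rV[R]_n, v != 0 -> 0 < (v *m G *m v^T) 0 0.

(** Induction on the size: the upper left entry is split off, and its Schur complement is again
    positive definite. *)
Lemma cholesky n (G : 'M[R]_n) : posdef G ->
  exists2 L : 'M[R]_n, L \in unitmx & G = L *m L^T.
Proof.
elim: n G => [|n IH] G [Gs Gp].
  by exists 1%:M; [exact: unitmx1 | apply/matrixP => -[]].
rewrite -[n.+1]/(1 + n)%N in G Gs Gp *.
pose a := ulsubmx G; pose b := ursubmx G; pose D := drsubmx G.
have GE : G = block_mx a b b^T D.
  rewrite -[LHS]submxK /a /b /D; congr block_mx.
  by rewrite /b trmx_ursub Gs.
have aT : a^T = a by apply/matrixP => i j; rewrite !ord1 mxE.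
have DT : D^T = D by rewrite /D trmx_drsub Gs.
pose s := a 0 0.
have aE : a = s%:M by rewrite [LHS]mx11_scalar.
have s0 : 0 < s.
  have := Gp (row_mx 1%:M 0).
  rewrite GE mul_row_block !mul0mx !addr0 !mul1mx tr_row_mx mul_row_col.
  rewrite trmx1 trmx0 mulmx0 addr0 mulmx1; apply.
  by apply/eqP => /matrixP/(_ 0 (lshift n 0))/eqP; rewrite row_mxEl !mxE oner_eq0.
have sn0 : s != 0 by rewrite gt_eqF.
pose E := D - s^-1 *: (b^T *m b).
have Ep : posdef E.
  split; first by rewrite linearB linearZ /= trmx_mul trmxK DT.
  (* The first coordinate that minimises the form: it kills the first entry of [row_mx c v *m G], so
     the form of [G] at [row_mx c v] is that of [E] at [v]. *)
  move=> v v0; pose c := - s^-1 *: (v *m b^T).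
  have := Gp (row_mx c v); rewrite GE mul_row_block tr_row_mx mul_row_col aE.
  rewrite [c *m _]mul_mx_scalar /c scalerA mulrN mulfV// scaleN1r addNr mul0mx add0r.
  have -> : - s^-1 *: (v *m b^T) *m b + v *m D = v *m E.
    by rewrite /E mulmxBr -scalemxAr addrC scaleNr mulNmx -scalemxAl mulmxA.
  apply; apply: contra_neq v0 => /eqP; rewrite row_mx_eq0 => /andP[_ /eqP->] //.
have [L Lu EL] := IH _ Ep.
pose r := Num.sqrt s.
have r0 : r != 0 by rewrite sqrtr_eq0 -ltNge.
have rr : r * r = s by rewrite -expr2 sqr_sqrtr// ltW.
exists (block_mx r%:M 0 (r^-1 *: b^T) L).
  by rewrite unitmxE det_lblock det_scalar1 unitrM unitfE r0 -unitmxE.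
rewrite tr_block_mx mulmx_block trmx0 !mul0mx !addr0 !mulmx0 addr0 tr_scalar_mx.
rewrite linearZ /= trmxK mul_scalar_mx scale_scalar_mx rr -!scalemxAl -!scalemxAr.
rewrite mul_scalar_mx !scalerA -invfM rr mulVf// !scale1r GE -aE -EL /E.
by rewrite [b^T *m _]mul_mx_scalar scalerA mulVf// scale1r [_ + (_ - _)]addrC subrK.
Qed.

Variables (n : nat) (G : 'M[R]_n).
Hypothesis Gpd : posdef G.

Lemma posdef_unit : G \in unitmx.
Proof. by have [L Lu ->] := cholesky Gpd; rewrite unitmx_mul unitmx_tr Lu. Qed.

Lemma posdef_invmx_sym : (invmx G)^T = invmx G.
Proof. by rewrite trmx_inv Gpd.1. Qed.

Lemma posdef_det_gt0 : 0 < \det G.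
Proof.
have [L Lu ->] := cholesky Gpd; rewrite det_mulmx det_tr -expr2.
by rewrite exprn_even_gt0//= -unitfE -unitmxE.
Qed.

(** The trace of [endo_sqnorm] at a single point, to which it unfolds; the Gram matrix is a plain
    argument, so the linear algebra needs no base point. *)
Definition sqnorm_endo (H : 'M[R]_n) : R := \tr (H *m G *m H^T *m invmx G).

(* Conjugation by a Cholesky factor passes to an orthonormal frame, where
   sqnorm_endo is the squared Frobenius norm. *)
Lemma orthonormal_frame : exists2 L : 'M[R]_n, L \in unitmx &
  [/\ forall H, sqnorm_endo H =
        \sum_i \sum_j (invmx L *m H *m L) i j ^+ 2,
      forall H, \tr H = \tr (invmx L *m H *m L),
      forall X : 'rV_n, (X *m G *m X^T) 0 0 = \sum_i (X *m L) 0 i ^+ 2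
    & forall H (X : 'rV_n), (X *m H *m G *m X^T) 0 0 =
        \sum_i \sum_j (invmx L *m H *m L) i j * ((X *m L) 0 i * (X *m L) 0 j)].
Proof.
have [L Lu GE] := cholesky Gpd; exists L => //; split.
- move=> H; rewrite /sqnorm_endo.
  have iG : invmx G = invmx L^T *m invmx L.
    by rewrite GE invmx_mulmx// unitmx_tr.
  rewrite iG mulmxA mxtrace_mulC.
  have -> : invmx L *m (H *m G *m H^T *m invmx L^T) =
     (invmx L *m H *m L) *m (invmx L *m H *m L)^T.
    by rewrite GE !trmx_mul trmx_inv !mulmxA.
  rewrite /mxtrace; apply: eq_bigr => i _; rewrite mxE.
  by apply: eq_bigr => j _; rewrite [_^T _ _]mxE expr2.
- by move=> H; rewrite mxtrace_mulC mulmxA mulmxV// mul1mx.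
- move=> X; rewrite GE mulmxA -mulmxA -trmx_mul mxE.
  by apply: eq_bigr => i _; rewrite [_^T _ _]mxE expr2.
- move=> H X; set K := invmx L *m H *m L; set Y := X *m L.
  have -> : X *m H *m G *m X^T = Y *m K *m Y^T.
    by rewrite /Y /K trmx_mul GE !mulmxA mulmxK.
  rewrite mxE exchange_big; apply: eq_bigr => j _ /=.
  rewrite mxE mulr_suml; apply: eq_bigr => i _; rewrite [_^T _ _]mxE; ring.
Qed.

Lemma sqnorm_endoZ a H : sqnorm_endo (a *: H) = a ^+ 2 * sqnorm_endo H.
Proof.
have [L _ [sqE _ _ _]] := orthonormal_frame; rewrite !sqE mulr_sumr.
apply: eq_bigr => i _; rewrite mulr_sumr; apply: eq_bigr => j _.
by rewrite -scalemxAr -scalemxAl mxE exprMn.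
Qed.

Lemma sqnorm_endoD_le H K :
  sqnorm_endo (H + K) <= 2 * (sqnorm_endo H + sqnorm_endo K).
Proof.
have [L _ [sqE _ _ _]] := orthonormal_frame; rewrite !sqE -big_split mulr_sumr.
apply: ler_sum => i _; rewrite -big_split mulr_sumr; apply: ler_sum => j _ /=.
rewrite mulmxDr mulmxDl mxE; set x := (_ *m _) i j; set y := (_ *m _) i j.
have := sqr_ge0 (x - y); nra.
Qed.

(** The norm of a rank one map is the product of the norms of its covector and its vector, and these
    agree when the vector is dual to the covector. *)
Lemma sqnorm_endo_rank1 (d : 'rV[R]_n) :
  let X := d *m invmx G in
  sqnorm_endo (d^T *m X) = (X *m G *m X^T) 0 0 ^+ 2.
Proof.
move=> X; have XG : X *m G = d by rewrite mulmxKV// posdef_unit.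
have XE : d *m invmx G = X by [].
have dX : d *m X^T = X *m d^T by rewrite -XE trmx_mul posdef_invmx_sym mulmxA.
clearbody X; have -> : X *m G *m X^T = X *m d^T by rewrite XG dX.
rewrite /sqnorm_endo trmx_mul trmxK -(mulmxA d^T) XG.
have -> : d^T *m d *m (X^T *m d) *m invmx G = d^T *m (X *m d^T *m X).
  by rewrite -dX -XE !mulmxA.
by rewrite mxtrace_mulC -(mulmxA (X *m d^T)) trace_mx11 mxE big_ord1 expr2.
Qed.

(** Both terms on the left are bounded by Young's inequality in an orthonormal frame. Each is
    allowed a quarter of N^2, so that half of the N^2 in the divergence survives. *)
Lemma sqnorm_endo_trace_le (H : 'M[R]_n) (X : 'rV[R]_n) :
  - (2 * (X *m H *m G *m X^T) 0 0 + (X *m G *m X^T) 0 0 * \tr H) <=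
  2^-1 * (X *m G *m X^T) 0 0 ^+ 2 + (n%:R + 4) * sqnorm_endo H.
Proof.
have [L _ [sqE trE NE HE]] := orthonormal_frame.
rewrite sqE trE HE NE; set K := invmx L *m H *m L; set Y := X *m L.
set N' := \sum_i Y 0 i ^+ 2; set S := \sum_i \sum_j K i j ^+ 2.
have N2 : N' ^+ 2 = \sum_i \sum_j (Y 0 i * Y 0 j) ^+ 2.
  rewrite expr2 mulr_suml; apply: eq_bigr => i _; rewrite mulr_sumr.
  by apply: eq_bigr => j _; rewrite exprMn.
have S_ge : \sum_i K i i ^+ 2 <= S.
  by apply: ler_sum => i _; rewrite (bigD1 i)//= lerDl; apply: sumr_ge0 => *; exact: sqr_ge0.
have H1 : - (2 * \sum_i \sum_j K i j * (Y 0 i * Y 0 j)) <= 4^-1 * N' ^+ 2 + 4 * S.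
  rewrite N2 !mulr_sumr -sumrN -big_split; apply: ler_sum => i _ /=.
  rewrite !mulr_sumr -sumrN -big_split; apply: ler_sum => j _ /=.
  set k := K i j; set y := Y 0 i * Y 0 j; rewrite -subr_ge0.
  by rewrite (_ : _ - _ = (2 * k + 2^-1 * y) ^+ 2) ?sqr_ge0//; field.
have H2 : - (N' * \tr K) <= 4^-1 * N' ^+ 2 + n%:R * S.
  (* The weights below divide by [n]; in dimension zero the trace is an empty sum. *)
  have [n0|n0] := posnP n.
    rewrite /mxtrace big1 => [|i _]; last first.
      by exfalso; have := leq_ltn_trans (leq0n i) (ltn_ord i); rewrite n0.
    have S0 : 0 <= S by do 2!apply: sumr_ge0 => ? _; exact: sqr_ge0.
    by rewrite mulr0 oppr0 addr_ge0 // mulr_ge0 // ?invr_ge0 ?sqr_ge0 // ler0n.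
  have nR : 0 < n%:R :> R by rewrite ltr0n.
  (* Cauchy-Schwarz for the trace, by completing one square per diagonal entry; the [n] shares
     [(4 * n%:R)^-1] of [N' ^+ 2] add up to a quarter. *)
  apply: (@le_trans _ _ (\sum_(i < n) ((4 * n%:R)^-1 * N' ^+ 2 + n%:R * K i i ^+ 2))).
    rewrite /mxtrace mulr_sumr -sumrN; apply: ler_sum => i _.
    set k := K i i; rewrite -subr_ge0.
    rewrite (_ : _ - _ = n%:R^-1 * (2^-1 * N' + n%:R * k) ^+ 2).
      by rewrite mulr_ge0 ?invr_ge0 ?sqr_ge0// ltW.
    by field; rewrite gt_eqF.
  rewrite big_split/= sumr_const card_ord -[X in X + _]mulr_natl mulrA -mulr_sumr.
  have -> : n%:R * (4 * n%:R)^-1 = 4^-1 :> R by field; rewrite gt_eqF.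
  by rewrite lerD2l ler_pM2l.
move: H1 H2; set a := \sum_i \sum_j _; set b := \tr K; lra.
Qed.

End positive_definite.

(** * Partial derivatives and functions of class C^k on R^n *)

Lemma continuous_rV (R : realType) m (T : topologicalType) (t : T -> 'rV[R]_m) x :
  (forall c, {for x, continuous (fun y => t y 0 c)}) -> {for x, continuous t}.
Proof.
move=> ct B /nbhs_ballP[e /= e0 eB].
have : \forall y \near x, forall c, ball (t x 0 c) e (t y 0 c).
  by apply: filter_forall => c; exact: (ct c _ (nbhsx_ballx _ _ e0)).
apply: filterS => y yB; apply: eB; split => // i j; rewrite ord1; exact: yB.
Qed.

Section partial_rules.
Context {R : realType} {n : nat}.
Implicit Types (f g : 'rV[R]_n -> R) (x : 'rV[R]_n) (i j : 'I_n).

(** The first order expansion of [f] at [x] is also one of [g], and [diff_unique] recognises its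
    linear part as the differential. *)
Lemma near_eq_differentiable (V W : normedModType R) (f g : V -> W) (x : V) :
  (\near x, f x = g x) -> differentiable f x -> differentiable g x.
Proof.
move=> fg df; have gE : g \o shift x = cst (g x) + 'd f x +o_0 id.
  have /eqaddoP fo := diff_locally df; apply/eqaddoP => e e0.
  have fg0 : \forall h \near 0, f (h + x) = g (h + x).
    by move: fg; rewrite (near_shift 0 x)/=; apply: filterS => h; rewrite /= subr0.
  apply: filterS2 fg0 (fo e e0) => h fgh.
  suff: `|f (h + x) - (f x + 'd f x h)| <= e * `|h| ->
        `|g (h + x) - (g x + 'd f x h)| <= e * `|h| by [].
  by rewrite fgh (nbhs_singleton fg).
have dE := diff_unique (diff_continuous df) gE.
by apply/diff_locallyP; rewrite dE; split => //; exact: diff_continuous.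
Qed.

Lemma partial_near_eq j f g x :
  (\near x, f x = g x) -> partial j f x = partial j g x.
Proof. by move=> fg; exact: near_eq_derive. Qed.

Lemma partial_cst j (c : R) x : partial j (cst c) x = 0.
Proof. exact: derive_cst. Qed.

Lemma partialD j f g x : differentiable f x -> differentiable g x ->
  partial j (fun y => f y + g y) x = partial j f x + partial j g x.
Proof. by move=> df dg; apply: deriveD; exact: diff_derivable. Qed.

Lemma partialM j f g x : differentiable f x -> differentiable g x ->
  partial j (fun y => f y * g y) x = f x * partial j g x + g x * partial j f x.
Proof. by move=> df dg; apply: deriveM; exact: diff_derivable. Qed.

Lemma differentiable_bigsum (I : Type) (r : seq I) (P : pred I)
    (F : I -> 'rV[R]_n -> R) x :
  (forall a, differentiable (F a) x) ->
  differentiable (fun y => \sum_(i <- r | P i) F i y) x.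
Proof.
move=> dF; elim: r => [|a r IH].
  by under eq_fun do rewrite big_nil; exact: differentiable_cst.
under eq_fun do rewrite big_cons.
by case: (P a) => //; exact: differentiableD.
Qed.

Lemma partial_sum (I : Type) (r : seq I) (P : pred I)
    (F : I -> 'rV[R]_n -> R) j x :
  (forall a, differentiable (F a) x) ->
  partial j (fun y => \sum_(i <- r | P i) F i y) x =
  \sum_(i <- r | P i) partial j (F i) x.
Proof.
move=> dF; elim: r => [|a r IH].
  rewrite big_nil (_ : (fun y => _) = cst 0) ?partial_cst//.
  by apply/funext => y; rewrite big_nil.
rewrite big_cons -IH; case: ifP => Pa; last first.
  by congr (partial j _ x); apply/funext => y; rewrite big_cons Pa.
rewrite -partialD//; last exact: differentiable_bigsum.
by congr (partial j _ x); apply/funext => y; rewrite big_cons Pa.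
Qed.

Lemma differentiable_comp1 (h : R -> R) dh f x : differentiable f x ->
  is_derive (f x) 1 h dh -> differentiable (h \o f) x.
Proof.
move=> df dhf; apply: differentiable_comp => //.
by apply/derivable1_diffP; case: dhf.
Qed.

Lemma partial_comp1 j (h : R -> R) dh f x : differentiable f x ->
  is_derive (f x) 1 h dh -> partial j (h \o f) x = dh * partial j f x.
Proof.
move=> df dhf; have dh' : differentiable h (f x).
  by apply/derivable1_diffP; case: dhf.
rewrite /partial deriveE; last exact: differentiable_comp.
rewrite diff_comp//= diff1E// derive1E -deriveE//.
by case: dhf => _ ->; rewrite mulrC.
Qed.

Lemma partialV j f x : differentiable f x -> f x != 0 ->
  partial j (fun y => (f y)^-1) x = - (f x) ^- 2 * partial j f x.
Proof.
move=> df fx; rewrite /partial deriveV//; exact: diff_derivable.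
Qed.

Lemma differentiable_rV m (t : 'rV[R]_n -> 'rV[R]_m) x :
  (forall c, differentiable (fun y => t y 0 c) x) -> differentiable t x.
Proof.
move=> dt; rewrite (_ : t = \sum_c (fun y => t y 0 c *: delta_mx 0 c)).
  by apply: differentiable_sum => c; exact: differentiableZl.
by apply/funext => y; rewrite {1}[t y]row_sum_delta fct_sumE.
Qed.

Lemma partial_vector m (t : 'rV[R]_n -> 'rV[R]_m) x j c : differentiable t x ->
  partial j (fun y => t y 0 c) x = partial j t x 0 c.
Proof.
move=> dt; rewrite /partial.
have @l : {linear 'rV[R]_m -> R}.
  by exists (fun N : 'rV[R]_m => N 0 c); do 2![eexists]; do ?[constructor];
     rewrite ?mxE// => ? *; rewrite ?mxE//; move=> ?; rewrite !mxE.
have lc : continuous l by exact: coord_continuous.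
rewrite -[fun y => t y 0 c]/(l \o t) deriveE; last first.
  by apply: differentiable_comp => //; exact: linear_differentiable.
rewrite diff_comp//; last exact: linear_differentiable.
by rewrite diff_lin//= -deriveE.
Qed.

Lemma partial_coord m (t : 'rV[R]_n -> 'rV[R]_m) x j c : differentiable t x ->
  partial j (fun y => t y 0 c) x = 'J t x j c.
Proof.
move=> dt; rewrite partial_vector// /partial.
by rewrite deriveEjacobian// -rowE [LHS]mxE.
Qed.

Lemma partial_coordinate j c x :
  partial j (fun y : 'rV[R]_n => y 0 c) x = (delta_mx 0 c : 'rV[R]_n) 0 j.
Proof.
have @l : {linear 'rV[R]_n -> R}.
  by exists (fun N : 'rV[R]_n => N 0 c); do 2![eexists]; do ?[constructor];
     rewrite ?mxE// => ? *; rewrite ?mxE//; move=> ?; rewrite !mxE.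
have lc : continuous l by exact: coord_continuous.
rewrite (_ : (fun y : 'rV[R]_n => y 0 c) = l)// /partial deriveE; last exact: linear_differentiable.
by rewrite diff_lin//= !mxE eq_sym.
Qed.

Lemma partial_comp m (t : 'rV[R]_n -> 'rV[R]_m) (f : 'rV[R]_m -> R) x j :
  differentiable t x -> differentiable f (t x) ->
  partial j (f \o t) x = \sum_c 'J t x j c * partial c f (t x).
Proof.
move=> dt df; rewrite /partial deriveE; last exact: differentiable_comp.
rewrite diff_comp//= -(deriveE _ dt) deriveEjacobian// -rowE.
rewrite {1}[row j _]row_sum_delta linear_sum; apply: eq_bigr => c _.
by rewrite linearZ/= -deriveE// mxE.
Qed.

End partial_rules.

(** * Functions of class C^k on a subset of R^n *)

Section Ck.
Context {R : realType} {n : nat}.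
Implicit Types (D : set 'rV[R]_n) (f g : 'rV[R]_n -> R).

(** Counts derivatives because the cut-off functions are only C^1. Partial derivatives of order
    below [k] are Frechet differentiable, those of order [k] continuous. Only points of [D] are
    tested, but with neighbourhoods in the whole space, whence the openness of [D] in most closure
    rules. *)
Fixpoint Ck k D f : Prop :=
  match k with
  | 0 => forall x, D x -> {for x, continuous f}
  | k.+1 => (forall x, D x -> differentiable f x) /\
            forall j, Ck k D (partial j f)
  end.

(** The derivative applied first is the last entry of the list under [foldr], hence [rcons]. *)
Lemma smooth_on_partial D f j : smooth_on D f -> smooth_on D (partial j f).
Proof. by move=> sf js x Dx; have := sf (rcons js j) x Dx; rewrite foldr_rcons. Qed.

Lemma smooth_on_Ck k D f : smooth_on D f -> Ck k D f.
Proof.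
elim: k f => [|k IH] f sf /=.
  by move=> x Dx; apply: differentiable_continuous; exact: (sf [::]).
split=> [x Dx|j]; first exact: (sf [::]).
exact/IH/smooth_on_partial.
Qed.

Lemma Ck_continuous k D f x : Ck k D f -> D x -> {for x, continuous f}.
Proof.
by case: k => [|k] /= => [|[df _] Dx]; [exact|exact/differentiable_continuous/df].
Qed.

Lemma Ck_differentiable k D f x : Ck k.+1 D f -> D x -> differentiable f x.
Proof. by move=> [+ _]; exact. Qed.

Lemma Ck_partial k D f j : Ck k.+1 D f -> Ck k D (partial j f).
Proof. by move=> [_ pf]; exact: pf. Qed.

Lemma CkS k D f : Ck k.+1 D f -> Ck k D f.
Proof.
elim: k f => [|k IH] f; first by move=> Cf x Dx; exact: Ck_continuous Cf Dx.
by move=> [df Cf]; split => // j; exact/IH/Cf.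
Qed.

Lemma Ck_le k l D f : (k <= l)%N -> Ck l D f -> Ck k D f.
Proof.
elim: l => [|l IH]; first by rewrite leqn0 => /eqP->.
by rewrite leq_eqVlt => /predU1P[->//|kl] /CkS; exact: IH.
Qed.

Lemma Ck_subset k D D' f : D' `<=` D -> Ck k D f -> Ck k D' f.
Proof.
move=> sD; elim: k f => [|k IH] f /=; first by move=> cf x /sD; exact: cf.
by move=> [df Cf]; split=> [x /sD|j]; [exact: df|exact: IH].
Qed.

(** Every clause of [Ck] is a condition at a single point, so a different set may serve each point.
    This is the gluing principle for bump functions and extensions by zero. *)
Lemma Ck_local k D f :
  (forall x, D x -> exists2 U, U x & Ck k U f) -> Ck k D f.
Proof.
elim: k f => [|k IH] f lf /=; first by move=> x /lf[U Ux]; exact.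
split=> [x /lf[U Ux []]|j]; first by move=> + _; exact.
by apply: IH => x /lf[U Ux [_ Cf]]; exists U => //; exact: Cf.
Qed.

Lemma Ck_eq k D f g : open D -> (forall x, D x -> f x = g x) ->
  Ck k D f -> Ck k D g.
Proof.
move=> oD; elim: k f g => [|k IH] f g fg.
  move=> cf x Dx; have Dn : \near x, f x = g x.
    by apply: filterS (open_nbhs_nbhs (conj oD Dx)) => y; exact: fg.
  suff: g y @[y --> x] --> g x by [].
  rewrite -fg//; apply: cvg_trans (cf x Dx).
  exact: (@near_eq_cvg _ _ (nbhs x) _ f g Dn).
have Dn x : D x -> \near x, f x = g x.
  by move=> Dx; apply: filterS (open_nbhs_nbhs (conj oD Dx)) => y; exact: fg.
move=> [df Cf]; split=> [x Dx|j].
  by apply: near_eq_differentiable (df x Dx); exact: Dn.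
by apply: IH (Cf j) => x Dx; apply: partial_near_eq; exact: Dn.
Qed.

Variable D : set 'rV[R]_n.
Hypothesis oD : open D.

Lemma Ck_cst k (c : R) : Ck k D (cst c).
Proof.
elim: k c => [|k IH] c /=; first by move=> x _; exact: cst_continuous.
split=> [x _|j]; first exact: differentiable_cst.
by apply: Ck_eq (IH 0) => // x _; rewrite partial_cst.
Qed.

Lemma Ck_coordinate k c : Ck k D (fun y => y 0 c).
Proof.
case: k => [|k]; first by move=> x _; exact: coord_continuous.
split=> [x _|j]; first exact: differentiable_coord.
by apply: Ck_eq (Ck_cst k ((delta_mx 0 c : 'rV[R]_n) 0 j)) => // x _; rewrite partial_coordinate.
Qed.

Lemma CkD k f g : Ck k D f -> Ck k D g -> Ck k D (fun x => f x + g x).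
Proof.
elim: k f g => [|k IH] f g.
  by move=> cf cg x Dx; apply: continuousD; [exact: cf|exact: cg].
move=> [df Cf] [dg Cg]; split=> [x Dx|j].
  by apply: differentiableD; [exact: df|exact: dg].
apply: (Ck_eq oD _ (IH _ _ (Cf j) (Cg j))) => x Dx.
by rewrite partialD//; [exact: df|exact: dg].
Qed.

Lemma CkM k f g : Ck k D f -> Ck k D g -> Ck k D (fun x => f x * g x).
Proof.
elim: k f g => [|k IH] f g.
  by move=> cf cg x Dx; apply: continuousM; [exact: cf|exact: cg].
move=> Cf Cg; have [[df pf] [dg pg]] := (Cf, Cg); split=> [x Dx|j].
  by apply: differentiableM; [exact: df|exact: dg].
apply: (Ck_eq oD _ (CkD (IH _ _ (CkS Cf) (pg j)) (IH _ _ (CkS Cg) (pf j)))).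
by move=> x Dx; rewrite partialM//; [exact: df|exact: dg].
Qed.

Lemma CkZ k (c : R) f : Ck k D f -> Ck k D (fun x => c * f x).
Proof. exact/CkM/Ck_cst. Qed.

Lemma CkN k f : Ck k D f -> Ck k D (fun x => - f x).
Proof. by move=> /(CkZ (-1)); apply: Ck_eq => // x _; rewrite mulN1r. Qed.

Lemma CkB k f g : Ck k D f -> Ck k D g -> Ck k D (fun x => f x - g x).
Proof. by move=> Cf /CkN; exact: CkD. Qed.

Lemma Ck_sum k (I : Type) (r : seq I) (P : pred I) (F : I -> 'rV[R]_n -> R) :
  (forall i, Ck k D (F i)) -> Ck k D (fun x => \sum_(i <- r | P i) F i x).
Proof.
move=> CF; elim: r => [|a r IH].
  by apply: Ck_eq (Ck_cst k 0) => // x _; rewrite big_nil.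
have [Pa|nPa] := boolP (P a).
  by apply: Ck_eq (CkD (CF a) IH) => // x _; rewrite big_cons Pa.
by apply: Ck_eq IH => // x _; rewrite big_cons (negbTE nPa).
Qed.

Lemma Ck_prod k (I : Type) (r : seq I) (P : pred I) (F : I -> 'rV[R]_n -> R) :
  (forall i, Ck k D (F i)) -> Ck k D (fun x => \prod_(i <- r | P i) F i x).
Proof.
move=> CF; elim: r => [|a r IH].
  by apply: Ck_eq (Ck_cst k 1) => // x _; rewrite big_nil.
have [Pa|nPa] := boolP (P a).
  by apply: Ck_eq (CkM (CF a) IH) => // x _; rewrite big_cons Pa.
by apply: Ck_eq IH => // x _; rewrite big_cons (negbTE nPa).
Qed.

Lemma CkV k f : (forall x, D x -> f x != 0) -> Ck k D f ->
  Ck k D (fun x => (f x)^-1).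
Proof.
move=> f0; elim: k => [|k IH] Cf.
  by move=> x Dx; apply: continuousV; [exact: f0|exact: Cf].
have [df pf] := Cf; split=> [x Dx|j].
  by apply: differentiableV; [exact: df|exact: f0].
have CV := IH (CkS Cf); apply: (Ck_eq oD _ (CkM (CkN (CkM CV CV)) (pf j))).
move=> x Dx; rewrite partialV//; [|exact: df|exact: f0].
by rewrite -expr2 exprVn.
Qed.

(** The regularity of [dh] along [f] is a hypothesis, so that it may come from another rule, as
    [CkV] for [ln], or from an induction, as for the square root, which reappears in its own
    derivative. *)
Lemma Ck_comp1 k (h dh : R -> R) f :
  (forall x, D x -> is_derive (f x) 1 h (dh (f x))) ->
  Ck k.+1 D f -> Ck k D (fun x => dh (f x)) -> Ck k.+1 D (fun x => h (f x)).
Proof.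
move=> dhf [df pf] Cdh; split=> [x Dx|j].
  exact: differentiable_comp1 (df x Dx) (dhf x Dx).
apply: (Ck_eq oD _ (CkM Cdh (pf j))) => x Dx.
by rewrite -(partial_comp1 j (df x Dx) (dhf x Dx)).
Qed.

Lemma Ck_ln k f : (forall x, D x -> 0 < f x) -> Ck k D f ->
  Ck k D (fun x => ln (f x)).
Proof.
move=> f0; case: k => [Cf x Dx|k Cf].
  by apply: continuous_comp; [exact: Cf|apply: continuous_ln; exact: f0].
apply: (@Ck_comp1 _ _ GRing.inv) => //.
  by move=> x Dx; apply: is_derive1_ln; exact: f0.
by apply: CkV (CkS Cf) => x Dx; rewrite gt_eqF// f0.
Qed.

Lemma Ck_sqrt k f : (forall x, D x -> 0 < f x) -> Ck k D f ->
  Ck k D (fun x => Num.sqrt (f x)).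
Proof.
move=> f0; elim: k => [Cf x Dx|k IH Cf].
  by apply: continuous_comp; [exact: Cf|exact: sqrt_continuous].
apply: (@Ck_comp1 _ _ (fun y => (2 * Num.sqrt y)^-1)) => //.
  by move=> x Dx; apply: is_derive1_sqrt; exact: f0.
apply: CkV; last by apply: CkZ; exact: IH (CkS Cf).
by move=> x Dx; rewrite mulf_neq0// gt_eqF// sqrtr_gt0 f0.
Qed.

Lemma Ck_det k m (B : 'rV[R]_n -> 'M[R]_m) :
  (forall i j, Ck k D (fun x => B x i j)) -> Ck k D (fun x => \det (B x)).
Proof.
move=> CB; apply: Ck_sum => s; apply: CkZ; apply: Ck_prod => i; exact: CB.
Qed.

(** Cramer's rule: the entries are cofactors divided by the determinant. *)
Lemma Ck_invmx k m (B : 'rV[R]_n -> 'M[R]_m) :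
  (forall x, D x -> B x \in unitmx) ->
  (forall i j, Ck k D (fun x => B x i j)) ->
  forall i j, Ck k D (fun x => invmx (B x) i j).
Proof.
move=> Bu CB i j.
have Cc : Ck k D (fun x => cofactor (B x) j i).
  by apply: CkZ; apply: Ck_det => a b; apply: Ck_eq (CB (lift j a) (lift i b)) => // x _; rewrite !mxE.
apply: (Ck_eq oD _ (CkM (CkV _ (Ck_det CB)) Cc)).
  by move=> x Dx; rewrite /invmx Bu// !mxE.
by move=> x Dx; rewrite -unitfE -unitmxE Bu.
Qed.

Lemma Ck_mulmx k m p q (B : 'rV[R]_n -> 'M[R]_(m, p)) (C : 'rV[R]_n -> 'M[R]_(p, q)) :
  (forall i j, Ck k D (fun x => B x i j)) ->
  (forall i j, Ck k D (fun x => C x i j)) ->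
  forall i j, Ck k D (fun x => (B x *m C x) i j).
Proof.
move=> CB CC i j.
apply: (@Ck_eq _ _ (fun x => \sum_l B x i l * C x l j)) => //.
  by move=> x _; rewrite mxE.
by apply: Ck_sum => l; exact: CkM.
Qed.

End Ck.

Lemma Ck_comp (R : realType) n m k (D : set 'rV[R]_n) (E : set 'rV[R]_m)
    (t : 'rV[R]_n -> 'rV[R]_m) (f : 'rV[R]_m -> R) : open D ->
  (forall x, D x -> E (t x)) -> (forall c, Ck k D (fun y => t y 0 c)) ->
  Ck k E f -> Ck k D (f \o t).
Proof.
move=> oD DE; elim: k f => [|k IH] f Ct Cf.
  move=> x Dx; apply: continuous_comp; last exact: Cf (DE _ Dx).
  by apply: continuous_rV => c; exact: Ct.
have dt x : D x -> differentiable t x.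
  by move=> Dx; apply: differentiable_rV => c; case: (Ct c) => + _; exact.
have [df pf] := Cf; split=> [x Dx|j].
  by apply: differentiable_comp; [exact: dt|exact/df/DE].
apply: (@Ck_eq _ _ _ _ (fun x => \sum_c partial j (fun y => t y 0 c) x * (partial c f \o t) x)) => //.
  move=> x Dx; rewrite partial_comp; [|exact: dt|exact/df/DE].
  by apply: eq_bigr => c _; rewrite partial_coord//; exact: dt.
apply: Ck_sum => // c; apply: CkM => //; first exact: Ck_partial (Ct c).
by apply: IH (pf c) => c'; exact/CkS/Ct.
Qed.

(** * Derivative of a determinant *)

Section partial_det.
Context {R : realType} {n : nat}.

Lemma differentiable_bigprod (I : Type) (r : seq I) (P : pred I)
    (F : I -> 'rV[R]_n -> R) x :
  (forall a, differentiable (F a) x) ->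
  differentiable (fun y => \prod_(i <- r | P i) F i y) x.
Proof.
move=> dF; elim: r => [|a r IH].
  by under eq_fun do rewrite big_nil; exact: differentiable_cst.
under eq_fun do rewrite big_cons.
by case: (P a) => //; exact: differentiableM.
Qed.

Lemma partial_prod (I : eqType) (r : seq I) (F : I -> 'rV[R]_n -> R) k x :
  uniq r -> (forall a, differentiable (F a) x) ->
  partial k (fun y => \prod_(i <- r) F i y) x =
  \sum_(i <- r) partial k (F i) x * \prod_(j <- r | j != i) F j x.
Proof.
move=> + dF; elim: r => [_|a r IH /andP[ar ur]].
  rewrite big_nil (_ : (fun y => _) = cst 1) ?partial_cst//.
  by apply/funext => y; rewrite big_nil.
rewrite (_ : (fun y => _) = fun y => F a y * \prod_(i <- r) F i y); last first.
  by apply/funext => y; rewrite big_cons.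
rewrite partialM//; last exact: differentiable_bigprod.
rewrite IH// big_cons big_cons eqxx/= addrC; congr (_ + _).
  rewrite mulrC; congr (_ * _); rewrite [LHS]big_seq [RHS]big_seq_cond.
  apply: eq_bigl => i; case: eqP => [->|]; rewrite ?andbT// andbF.
  exact/negbTE.
rewrite mulr_sumr [LHS]big_seq [RHS]big_seq; apply: eq_bigr => i ir.
rewrite big_cons (_ : a != i); first by rewrite mulrCA.
by apply: contraNneq ar => ->.
Qed.

(** Jacobi's formula. Differentiating one factor in every Leibniz product gives determinants with a
    single row differentiated; expanding each along that row produces the cofactors of [B x]. *)
Lemma partial_det m (B : 'rV[R]_n -> 'M[R]_m) k x :
  (forall i j, differentiable (fun y => B y i j) x) ->
  partial k (fun y => \det (B y)) x =
  \sum_i \sum_j partial k (fun y => B y i j) x * cofactor (B x) i j.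
Proof.
move=> dB; pose F (s : 'S_m) y := (-1) ^+ s * \prod_i B y i (s i).
have dP (s : 'S_m) : differentiable (fun y => \prod_i B y i (s i)) x.
  exact: differentiable_bigprod.
have dF s : differentiable (F s) x.
  by apply: differentiableM => //; exact: differentiable_cst.
rewrite [LHS](@partial_sum _ _ _ _ _ F)//.
pose Bi i := \matrix_(a, b) if a == i then partial k (fun y => B y a b) x else B x a b.
transitivity (\sum_i \det (Bi i)).
  rewrite exchange_big; apply: eq_bigr => s _ /=.
  rewrite [LHS](@partialM _ _ k (cst ((-1) ^+ s)) _ x (differentiable_cst _ _) (dP s)).
  rewrite partial_cst mulr0 addr0 partial_prod ?index_enum_uniq// mulr_sumr.
  apply: eq_bigr => i _; congr (_ * _); rewrite [RHS](bigD1 i)//=.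
  rewrite mxE eqxx; congr (_ * _); apply: eq_bigr => j ji.
  by rewrite mxE (negbTE ji).
apply: eq_bigr => i _; rewrite (expand_det_row _ i); apply: eq_bigr => j _.
rewrite [X in X * _]mxE eqxx; congr (_ * (_ * \det _)).
by apply/matrixP => a b; rewrite !mxE eq_sym (negbTE (neq_lift _ _)).
Qed.

Lemma partial_det_unit m (B : 'rV[R]_n -> 'M[R]_m) k x :
  (forall i j, differentiable (fun y => B y i j) x) -> B x \in unitmx ->
  partial k (fun y => \det (B y)) x =
  \det (B x) * \sum_i \sum_j partial k (fun y => B y i j) x * invmx (B x) j i.
Proof.
move=> dB Bu; rewrite partial_det// mulr_sumr; apply: eq_bigr => i _.
rewrite mulr_sumr; apply: eq_bigr => j _.
rewrite /invmx Bu !mxE [RHS]mulrCA mulVKf//.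
by rewrite -unitfE -unitmxE.
Qed.

End partial_det.

(** * Symmetry of second partial derivatives *)

Section mixed_partials.
Context {R : realType} {n : nat}.
Implicit Types (f : 'rV[R]_n -> R).

Lemma is_derive_line f (p v : 'rV[R]_n) (t : R) :
  differentiable f (p + t *: v) ->
  is_derive t 1 (fun s => f (p + s *: v)) ('D_v f (p + t *: v)).
Proof.
move=> df; have dl : derivable f (p + t *: v) v by exact: diff_derivable.
have E : (fun h : R => h^-1 *: (f (p + (h *: 1 + t) *: v) - f (p + t *: v))) =
         (fun h : R => h^-1 *: (f (h *: v + (p + t *: v)) - f (p + t *: v))).
  apply/funext => h; congr (_ *: (f _ - _)).
  by rewrite [h%:A]mulr1 scalerDl addrCA.
by apply: DeriveDef; rewrite /derivable /derive E.
Qed.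

Lemma MVT_0h (k dk : R -> R) (h : R) : 0 < h ->
  (forall t : R, 0 <= t <= h -> is_derive t 1 k (dk t)) ->
  exists2 t : R, 0 < t < h & k h - k 0 = h * dk t.
Proof.
move=> h0 kd; have kd' (t : R) : t \in `]0, h[ -> is_derive t 1 k (dk t).
  by rewrite in_itv/= => /andP[t0 th]; apply: kd; rewrite !ltW.
have kc : {within `[0, h], continuous k}.
  apply: derivable_within_continuous => t; rewrite in_itv/= => th.
  by have [] := kd t th.
have [t th E] := MVT h0 kd' kc.
by exists t; [rewrite in_itv/= in th|rewrite E subr0 mulrC].
Qed.

(** The mean value theorem twice: for the increment in direction [j], as a function of the position
    along [i], and then for the [i]-th partial derivative along [j]. *)
Lemma second_difference (D : set 'rV[R]_n) f (i j : 'I_n) (x : 'rV[R]_n) (h : R) :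
  0 < h -> Ck 2 D f ->
  (forall s t : R, 0 <= s <= h -> 0 <= t <= h ->
     D (x + s *: delta_mx 0 i + t *: delta_mx 0 j)) ->
  exists s t : R, [/\ 0 < s < h, 0 < t < h &
   f (x + h *: delta_mx 0 i + h *: delta_mx 0 j) - f (x + h *: delta_mx 0 i)
   - f (x + h *: delta_mx 0 j) + f x =
   h ^+ 2 * partial j (partial i f) (x + s *: delta_mx 0 i + t *: delta_mx 0 j)].
Proof.
move=> h0 Cf xD; set e := delta_mx 0 i; set e' := delta_mx 0 j.
have hh : 0 <= h <= h by rewrite lexx ltW.
have h00 : (0 : R) <= 0 <= h by rewrite lexx ltW.
have df y : D y -> differentiable f y by move=> Dy; exact: Ck_differentiable Cf Dy.
have dpf y : D y -> differentiable (partial i f) y.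
  by move=> Dy; exact: Ck_differentiable (Ck_partial i Cf) Dy.
pose g (s : R) := f (x + h *: e' + s *: e) - f (x + s *: e).
pose dg (s : R) := partial i f (x + h *: e' + s *: e) - partial i f (x + s *: e).
have D1 s : 0 <= s <= h -> D (x + h *: e' + s *: e).
  by move=> sh; rewrite addrAC; exact: xD.
have D0 s : 0 <= s <= h -> D (x + s *: e).
  by move=> sh; rewrite -[X in D X]addr0 -(scale0r e'); exact: xD.
have gd s : 0 <= s <= h -> is_derive s 1 g (dg s).
  by move=> sh; apply: is_deriveB; apply: is_derive_line; apply: df; [exact: D1|exact: D0].
have [s sh gs] := MVT_0h h0 gd.
have sh' : 0 <= s <= h by case/andP: sh => *; rewrite !ltW.
pose k (t : R) := partial i f (x + s *: e + t *: e').
pose dk (t : R) := partial j (partial i f) (x + s *: e + t *: e').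
have kd t : 0 <= t <= h -> is_derive t 1 k (dk t).
  by move=> th; apply: is_derive_line; apply: dpf; exact: xD.
have [t th kt] := MVT_0h h0 kd.
exists s, t; split => //; rewrite -/(dk t) expr2 -mulrA -kt.
rewrite (_ : k h - k 0 = dg s); last first.
  by rewrite /k /dg scale0r addr0 (addrAC x).
rewrite -gs /g !scale0r !addr0 (addrAC x (h *: e')).
by rewrite opprB addrA addrAC.
Qed.

(** The second difference is symmetric in [i] and [j], so the two mixed derivatives agree at two,
    possibly different, points of a small square; continuity brings both points to [x]. *)
Lemma partialC (D : set 'rV[R]_n) f i j x : open D -> Ck 2 D f -> D x ->
  partial i (partial j f) x = partial j (partial i f) x.
Proof.
move=> oD Cf Dx; apply/eqP; rewrite -subr_eq0 -normr_le0; apply/ler_addgt0Pl => eps eps0.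
rewrite addr0.
have e20 : 0 < eps / 2 by rewrite divr_gt0.
have cc a b : {for x, continuous (partial a (partial b f))}.
  exact: Ck_continuous (Ck_partial a (Ck_partial b Cf)) Dx.
have [r /= r0 rP] : exists2 r : R, 0 < r & forall y, ball x r y ->
   [/\ D y, `|partial i (partial j f) x - partial i (partial j f) y| < eps / 2 &
     `|partial j (partial i f) x - partial j (partial i f) y| < eps / 2].
  have H1 := open_nbhs_nbhs (conj oD Dx).
  have /cvgrPdist_lt/(_ _ e20) H2 := cc i j.
  have /cvgrPdist_lt/(_ _ e20) H3 := cc j i.
  have : nbhs x (D `&` ([set y | `|partial i (partial j f) x - partial i (partial j f) y| < eps / 2]
      `&` [set y | `|partial j (partial i f) x - partial j (partial i f) y| < eps / 2])).
    exact: filterI H1 (filterI H2 H3).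
  move=> /nbhs_ballP[r r0 rP].
  exists r; first exact: r0.
  move=> y yr; have [Dy [p q]] := rP y yr; split; [exact: Dy|exact: p|exact: q].
set e := delta_mx 0 i : 'rV[R]_n; set e' := delta_mx 0 j : 'rV[R]_n.
(* With this [c] the square of side [h] at [x] has all its points within [h * c = r / 2] of [x]; the
   summand 1 keeps [c] positive. *)
pose c := `|e| + `|e'| + 1.
have c0 : 0 < c by rewrite ltr_wpDl// addr_ge0.
pose h := r / (2 * c).
have h0 : 0 < h by rewrite divr_gt0// mulr_gt0.
have xB s t : 0 <= s <= h -> 0 <= t <= h ->
    ball x r (x + s *: e + t *: e').
  move=> /andP[s0 sh] /andP[t0 th]; rewrite -ball_normE/= -addrA opprD addNKr normrN.
  apply: le_lt_trans (ler_normD _ _) _; rewrite !normrZ !ger0_norm//.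
  apply: (@le_lt_trans _ _ (h * c)).
    rewrite /c !mulrDr mulr1 -[leLHS]addr0; apply: lerD; last exact: ltW.
    by apply: lerD; exact: ler_wpM2r.
  rewrite /h invfM mulrA -mulrA mulVf ?gt_eqF// mulr1 ltr_pdivrMr//; lra.
have [s [t [/andP[s0 sh] /andP[t0 th] E1]]] := @second_difference D f i j x h h0 Cf
  (fun s t sh th => let: And3 Dy _ _ := rP _ (xB s t sh th) in Dy).
have xB' (a b : R) : 0 <= a <= h -> 0 <= b <= h ->
    ball x r (x + a *: e' + b *: e).
  by move=> ha hb; rewrite addrAC; exact: xB.
have [s' [t' [/andP[s'0 s'h] /andP[t'0 t'h] E2]]] := @second_difference D f j i x h h0 Cf
  (fun s t sh th => let: And3 Dy _ _ := rP _ (xB' s t sh th) in Dy).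
have E : partial j (partial i f) (x + s *: e + t *: e') =
         partial i (partial j f) (x + s' *: e' + t' *: e).
  apply: (@mulfI _ (h ^+ 2)); first by rewrite expf_neq0// gt_eqF.
  apply: (etrans (esym E1)); apply: (etrans _ E2); congr (_ + _).
  by rewrite (addrAC x); exact: addrAC.
have [_ _ B1] := rP _ (xB s t (introT andP (conj (ltW s0) (ltW sh))) (introT andP (conj (ltW t0) (ltW th)))).
have [_ B2 _] := rP _ (xB' s' t' (introT andP (conj (ltW s'0) (ltW s'h))) (introT andP (conj (ltW t'0) (ltW t'h)))).
rewrite E in B1; rewrite distrC in B1; apply/ltW.
apply: le_lt_trans (ler_distD _ _ _) _; rewrite [ltRHS]splitr; exact: ltrD B2 B1.
Qed.

End mixed_partials.

(** * Hessians in a chart *)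

Lemma mx11T (R : Type) (M : 'M[R]_1) : M 0 0 = M^T 0 0.
Proof. by rewrite mxE. Qed.

Lemma bilinear_formC (R : comPzRingType) n (B : 'M[R]_n) (v w : 'rV[R]_n) :
  B^T = B -> (v *m B *m w^T) 0 0 = (w *m B *m v^T) 0 0.
Proof. by move=> BT; rewrite [LHS]mx11T !trmx_mul trmxK BT mulmxA. Qed.

Section local_geometry.
Context {R : realType} {n : nat}.
Variables (D : set 'rV[R]_n) (G : 'rV[R]_n -> 'M[R]_n).
Implicit Types X Y : 'rV[R]_n -> 'rV[R]_n.
Hypothesis oD : open D.
Hypothesis GC : forall i j, Ck 1 D (fun y => G y i j).
Hypothesis Gpd : forall x, D x -> posdef (G x).

Lemma covariant_derivativeE X x i k : covariant_derivative G X x i k =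
  partial i (fun y => X y 0 k) x + \sum_j christoffel G k i j x * X x 0 j.
Proof. by rewrite mxE. Qed.

Let Gu x : D x -> G x \in unitmx. Proof. by move=> Dx; exact/posdef_unit/Gpd. Qed.

Let open_near (P : 'rV[R]_n -> Prop) x :
  D x -> (forall y, D y -> P y) -> \near x, P x.
Proof. by move=> Dx DP; apply: filterS (open_nbhs_nbhs (conj oD Dx)). Qed.

Let Gsym x : D x -> \near x, (G x)^T = G x.
Proof. by move=> Dx; apply: open_near Dx _ => y /Gpd[]. Qed.

Let dG x i j : D x -> differentiable (fun y => G y i j) x.
Proof. by move=> Dx; exact: Ck_differentiable (GC i j) Dx. Qed.

Let GE x a b : D x -> G x a b = G x b a.
Proof. by move=> /Gpd[Gs _]; rewrite -{1}Gs mxE. Qed.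

Let pGE x k a b : D x ->
  partial k (fun y => G y a b) x = partial k (fun y => G y b a) x.
Proof.
by move=> Dx; apply: partial_near_eq; apply: open_near Dx _ => y Dy; exact: GE.
Qed.

(** Lowering the index cancels the inverse metric and leaves the Koszul formula for coordinate
    fields. *)
Lemma christoffel_lower k a b x : D x ->
  \sum_l christoffel G l k a x * G x l b =
  2^-1 * (partial k (fun y => G y a b) x + partial a (fun y => G y k b) x
          - partial b (fun y => G y k a) x).
Proof.
move=> Dx; pose T l := partial k (fun y => G y a l) x
  + partial a (fun y => G y k l) x - partial l (fun y => G y k a) x.
transitivity (2^-1 * \sum_m T m * (G x *m invmx (G x)) b m).
  rewrite mulr_sumr; under eq_bigr do rewrite /christoffel mulr_sumr mulr_suml.
  rewrite exchange_big; apply: eq_bigr => m _ /=.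
  rewrite mxE !mulr_sumr; apply: eq_bigr => l _.
  by rewrite (GE l b Dx) /T; ring.
rewrite mulmxV ?Gu// (bigD1 b)//= mxE eqxx big1 ?addr0 ?mulr1// => m mb.
by rewrite mxE eq_sym (negbTE mb) mulr0.
Qed.


(** Metric compatibility, passed from coordinate fields to arbitrary ones by the product rule. *)
Lemma covariant_derivative_metric X Y b x : D x ->
  (forall c, differentiable (fun y => X y 0 c) x) ->
  (forall c, differentiable (fun y => Y y 0 c) x) ->
  partial b (fun y => (X y *m G y *m (Y y)^T) 0 0) x =
  (covariant_derivative G X x *m G x *m (Y x)^T) b 0 +
  (covariant_derivative G Y x *m G x *m (X x)^T) b 0.
Proof.
move=> Dx dX dY.
have dXY a c : differentiable (fun y => X y 0 a * Y y 0 c) x by exact: differentiableM.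
have dXYG a c : differentiable (fun y => X y 0 a * Y y 0 c * G y a c) x.
  by apply: differentiableM => //; exact: dG.
have expand : (fun y => (X y *m G y *m (Y y)^T) 0 0) =
    (fun y => \sum_a \sum_c X y 0 a * Y y 0 c * G y a c).
  apply/funext => y; rewrite mxE exchange_big; apply: eq_bigr => c _ /=.
  rewrite mxE mulr_suml; apply: eq_bigr => a _; rewrite [_^T _ _]mxE; ring.
rewrite expand partial_sum => [|a]; last exact: differentiable_bigsum.
under eq_bigr => a _ do rewrite partial_sum//.
under eq_bigr => a _ do under eq_bigr => c _ do
  rewrite (partialM b (dXY a c) (dG a c Dx)) (partialM b (dX a) (dY c))
          (christoffel_metric a c b (Gsym Dx) (Gu Dx)).
have covE (Z W : 'rV[R]_n -> 'rV[R]_n) : (covariant_derivative G Z x *m G x *m (W x)^T) b 0 =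
    \sum_a \sum_c W x 0 c * G x a c * partial b (fun y => Z y 0 a) x +
    \sum_a \sum_c \sum_l Z x 0 a * W x 0 c * (christoffel G l b a x * G x l c).
  rewrite mxE exchange_big /= [X in _ = _ + X]exchange_big -big_split/=.
  apply: eq_bigr => c _; rewrite mxE mulr_suml [X in _ = _ + X]exchange_big -big_split/=.
  apply: eq_bigr => l _; rewrite !mxE mulrDl mulrDl; congr (_ + _); first ring.
  by rewrite !mulr_suml; apply: eq_bigr => a _; ring.
rewrite (covE X Y) (covE Y X).
rewrite [X in _ + (X + _)]exchange_big [X in _ + (_ + X)]exchange_big -!big_split/=.
apply: eq_bigr => a _; rewrite -!big_split/=; apply: eq_bigr => c _.
rewrite (GE c a Dx) mulr_sumr [LHS]addrC [RHS]addrACA -big_split/=.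
congr (_ + _); first by ring.
 apply: eq_bigr => l _; rewrite (GE a l Dx); ring.
Qed.

(** By Jacobi's formula the logarithmic derivative of sqrt (det G) in direction b is half the trace
    of G^-1 d_b G, and this is the contracted Christoffel symbol. It links the trace of the
    connection to a plain coordinate divergence. *)
Lemma divergence_volume X x : D x ->
  (forall c, differentiable (fun y => X y 0 c) x) ->
  \sum_b partial b (fun y => X y 0 b * Num.sqrt (\det (G y))) x =
  Num.sqrt (\det (G x)) * \tr (covariant_derivative G X x).
Proof.
move=> Dx dX; set s := Num.sqrt _.
have det0 : 0 < \det (G x) by exact/posdef_det_gt0/Gpd.
have s0 : s != 0 by rewrite gt_eqF// sqrtr_gt0.
have ddet : differentiable (fun y => \det (G y)) x.
  exact: Ck_differentiable (Ck_det oD GC) Dx.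
have ds : differentiable (fun y => Num.sqrt (\det (G y))) x.
  by apply: differentiable_comp1 ddet _; exact: is_derive1_sqrt.
have ps b : partial b (fun y => Num.sqrt (\det (G y))) x = s *
    (2^-1 * \sum_i \sum_j partial b (fun y => G y i j) x * invmx (G x) j i).
  rewrite (@partial_comp1 _ _ b Num.sqrt _ _ _ ddet (is_derive1_sqrt det0)) -/s.
  rewrite partial_det_unit ?Gu//; last by move=> i j; exact: dG.
  rewrite -{1}(sqr_sqrtr (ltW det0)) -/s; field.
  by rewrite s0.
have trE : \sum_i \sum_j christoffel G i i j x * X x 0 j =
    \sum_b X x 0 b * (2^-1 * \sum_i \sum_j partial b (fun y => G y i j) x * invmx (G x) j i).
  rewrite exchange_big; apply: eq_bigr => b _ /=; rewrite -mulr_suml mulrC; congr (_ * _).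
  rewrite -mulr_sumr; congr (_ * _).
  have iE i j : invmx (G x) i j = invmx (G x) j i.
    by rewrite -{1}(posdef_invmx_sym (Gpd Dx)) mxE.
  pose S1 := \sum_i \sum_l invmx (G x) i l * partial i (fun y => G y b l) x.
  pose S2 := \sum_i \sum_l invmx (G x) i l * partial b (fun y => G y i l) x.
  pose S3 := \sum_i \sum_l invmx (G x) i l * partial l (fun y => G y i b) x.
  (* [S1] and [S3] are the same sum with the two indices exchanged, so only [S2] is left. *)
  transitivity (S1 + S2 - S3).
    rewrite -big_split -sumrB; apply: eq_bigr => i _ /=.
    by rewrite -big_split -sumrB; apply: eq_bigr => l _ /=; ring.
  rewrite /S1 exchange_big/=.
  rewrite [X in X + _ - _](_ : _ =
      S3); last first.
    by apply: eq_bigr => i _; apply: eq_bigr => l _; rewrite iE (pGE _ b i Dx).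
  rewrite addrAC subrr add0r.
  by apply: eq_bigr => i _; apply: eq_bigr => l _; rewrite iE mulrC.
under eq_bigr => b _ do rewrite partialM// ps.
rewrite big_split/= addrC -mulr_sumr -/s.
rewrite [X in _ + X](_ : _ = s * \sum_b X x 0 b *
   (2^-1 * \sum_i \sum_j partial b (fun y => G y i j) x * invmx (G x) j i)); last first.
  by rewrite mulr_sumr; apply: eq_bigr => b _; rewrite mulrCA.
rewrite -trE -mulrDr -big_split; congr (_ * _).
by apply: eq_bigr => b _; rewrite mxE.
Qed.

Opaque covariant_derivative.

(** The inner product g(grad f, grad h), written as the derivative of h along grad f, which makes it
    visibly a derivation in h. *)
Definition grad_dot (f h : 'rV[R]_n -> R) x : R :=
  (gradient G f x *m (differential h x)^T) 0 0.

Lemma gradient_metric f x : D x -> gradient G f x *m G x = differential f x.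
Proof. by move=> Dx; rewrite mulmxKV// Gu. Qed.

Lemma grad_dotE f h x : D x ->
  grad_dot f h x = (gradient G f x *m G x *m (gradient G h x)^T) 0 0.
Proof.
move=> Dx; rewrite /grad_dot -[in LHS](gradient_metric h Dx) trmx_mul.
by rewrite (Gpd Dx).1 mulmxA.
Qed.

Lemma grad_dot_sum f h x :
  grad_dot f h x = \sum_c gradient G f x 0 c * partial c h x.
Proof. by rewrite /grad_dot mxE; apply: eq_bigr => c _; rewrite !mxE. Qed.

Lemma grad_dotC f h x : D x -> grad_dot f h x = grad_dot h f x.
Proof.
move=> Dx; rewrite (grad_dotE f h Dx) (grad_dotE h f Dx); apply: bilinear_formC; exact: (Gpd Dx).1.
Qed.

Lemma near_eq_differential (f h : 'rV[R]_n -> R) x :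
  (\near x, f x = h x) -> differential f x = differential h x.
Proof.
by move=> fh; apply/rowP => c; rewrite !mxE; exact: partial_near_eq.
Qed.

Lemma grad_dot_near_eq f h h' x : (\near x, h x = h' x) ->
  grad_dot f h x = grad_dot f h' x.
Proof. by move=> hh; rewrite /grad_dot (near_eq_differential hh). Qed.

(** The bound [k <= 1] reflects that the metric is only assumed to be of class C^1 here. *)
Lemma Ck_gradient k f c : (k <= 1)%N -> Ck k.+1 D f ->
  Ck k D (fun y => gradient G f y 0 c).
Proof.
move=> k1 Cf; apply: (@Ck_mulmx _ _ _ oD k _ _ _ (fun y => differential f y)
    (fun y => invmx (G y))) => i j.
  apply: (Ck_eq oD _ (Ck_partial j Cf)) => x Dx.
  by rewrite !mxE.
by apply: Ck_invmx => // a b; apply: Ck_le (GC a b).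
Qed.

Lemma Ck_grad_dot k f h : (k <= 1)%N -> Ck k.+1 D f -> Ck k.+1 D h ->
  Ck k D (grad_dot f h).
Proof.
move=> k1 Cf Ch.
apply: (@Ck_eq _ _ k D (fun y => \sum_c gradient G f y 0 c * partial c h y)) => //.
  by move=> x _; rewrite grad_dot_sum.
apply: Ck_sum => // c; apply: CkM => //; first exact: Ck_gradient.
exact: Ck_partial.
Qed.

Lemma Ck_hessian f a b : Ck 2 D f -> Ck 0 D (fun y => hessian G f y a b).
Proof.
move=> Cf.
have CX c : Ck 1 D (fun y => gradient G f y 0 c) by exact: Ck_gradient.
have Cc i j k : Ck 0 D (christoffel G k i j).
  apply: CkZ => //; apply: Ck_sum => // l; apply: CkM => //.
    by apply: Ck_invmx => // ? ?; exact/CkS/GC.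
  by apply: CkB => //; first apply: CkD => //; exact/Ck_partial/GC.
apply: (@Ck_eq _ _ 0 D (fun y => partial a (fun z => gradient G f z 0 b) y +
    \sum_j christoffel G b a j y * gradient G f y 0 j)) => //.
  by move=> x _; rewrite covariant_derivativeE.
apply: CkD => //; first exact: Ck_partial (CX b).
by apply: Ck_sum => // j; apply: CkM => //; exact: CkS.
Qed.

Lemma Ck_sqnorm_hessian f : Ck 2 D f ->
  Ck 0 D (fun y => sqnorm_endo (G y) (hessian G f y)).
Proof.
move=> Cf; apply: Ck_sum => // i.
have CG a b : Ck 0 D (fun y => G y a b) by exact/CkS/GC.
have CH a b := @Ck_hessian f a b Cf.
apply: (@Ck_mulmx _ _ _ oD 0) => [a b|a b]; last exact: Ck_invmx.
apply: (@Ck_mulmx _ _ _ oD 0) => [a' b'|a' b']; first exact: Ck_mulmx.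
by apply: Ck_eq (CH b' a') => // x _; rewrite [RHS]mxE.
Qed.

(** Differentiating df = X G trades the derivatives of the components of X for second partial
    derivatives of f. The result is visibly symmetric in [a] and [b] once mixed partials commute. *)
Lemma hessian_metricE f a b x : Ck 2 D f -> D x ->
  (hessian G f x *m G x) a b = partial a (partial b f) x -
  \sum_j gradient G f x 0 j * (2^-1 * (partial a (fun y => G y b j) x
    + partial b (fun y => G y a j) x - partial j (fun y => G y a b) x)).
Proof.
move=> Cf Dx; set X := gradient G f.
have dX c : differentiable (fun y => X y 0 c) x.
  exact: (Ck_differentiable (@Ck_gradient 1 f c isT Cf) Dx).
have pf : partial a (partial b f) x =
    \sum_k (X x 0 k * partial a (fun y => G y k b) x + G x k b * partial a (fun y => X y 0 k) x).
  under eq_bigr => k _ do rewrite -(partialM a (dX k) (dG k b Dx)).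
  rewrite -partial_sum => [|k]; last by apply: differentiableM => //; exact: dG.
  apply: partial_near_eq; apply: open_near Dx _ => y Dy.
  have /rowP/(_ b) := gradient_metric f Dy; rewrite !mxE => <-.
  by apply: eq_bigr => k _; rewrite mxE.
rewrite pf mxE; under eq_bigr => k _ do rewrite covariant_derivativeE mulrDl.
rewrite [LHS]big_split/= [X in _ = X - _]big_split/= [X in _ = X - _]addrC -addrA.
congr (_ + _); first by apply: eq_bigr => k _; rewrite mulrC.
transitivity (\sum_j X x 0 j * (\sum_k christoffel G k a j x * G x k b)).
  under eq_bigr => k _ do rewrite mulr_suml.
  rewrite exchange_big; apply: eq_bigr => j _ /=; rewrite mulr_sumr.
  by apply: eq_bigr => k _; rewrite /X; ring.
rewrite -sumrB; apply: eq_bigr => j _; rewrite christoffel_lower//.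
by rewrite (pGE a b j Dx) (pGE b a j Dx) (pGE b j a Dx); field.
Qed.

Lemma eq_hessian f h x : (forall y, D y -> f y = h y) -> D x ->
  hessian G f x = hessian G h x.
Proof.
move=> fh Dx; have grad_eq y : D y -> gradient G f y = gradient G h y.
  move=> Dy; rewrite /gradient; congr (_ *m _); apply: near_eq_differential.
  exact: open_near Dy _.
have pE i k : partial i (fun y => gradient G f y 0 k) x = partial i (fun y => gradient G h y 0 k) x.
  by apply: partial_near_eq; apply: open_near Dx _ => y Dy; rewrite (grad_eq y Dy).
apply/matrixP => i k.
rewrite [LHS]covariant_derivativeE [RHS]covariant_derivativeE pE.
by rewrite (grad_eq x Dx).
Qed.

Opaque gradient hessian.

Lemma hessian_metric_sym f x : Ck 2 D f -> D x ->
  (hessian G f x *m G x)^T = hessian G f x *m G x.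
Proof.
move=> Cf Dx; apply/matrixP => a b; rewrite mxE.
rewrite (hessian_metricE a b Cf Dx) (hessian_metricE b a Cf Dx).
rewrite (partialC b a oD Cf Dx); congr (_ - _); apply: eq_bigr => j _.
by rewrite (pGE j b a Dx) (addrC (partial b _ x)).
Qed.

Lemma partial_grad_dot f h b x : Ck 2 D f -> Ck 2 D h -> D x ->
  partial b (grad_dot f h) x =
  (hessian G f x *m G x *m (gradient G h x)^T) b 0 +
  (hessian G h x *m G x *m (gradient G f x)^T) b 0.
Proof.
move=> Cf Ch Dx; rewrite -covariant_derivative_metric//.
- by apply: partial_near_eq; apply: open_near Dx _ => y; exact: grad_dotE.
- by move=> c; exact: (Ck_differentiable (@Ck_gradient 1 f c isT Cf) Dx).
- by move=> c; exact: (Ck_differentiable (@Ck_gradient 1 h c isT Ch) Dx).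
Qed.

(** The Hessian of f as a bilinear form, on gradients only. Nothing is lost, since the gradients of
    coordinate functions span the tangent space. *)
Definition hess_form (f h k : 'rV[R]_n -> R) x : R :=
  (gradient G h x *m (hessian G f x *m G x) *m (gradient G k x)^T) 0 0.

Lemma hess_formC f h k x : Ck 2 D f -> D x ->
  hess_form f h k x = hess_form f k h x.
Proof. by move=> Cf Dx; apply: bilinear_formC; exact: hessian_metric_sym. Qed.

Lemma grad_dot_grad_dot f h k x : Ck 2 D f -> Ck 2 D h -> D x ->
  grad_dot k (grad_dot f h) x = hess_form f k h x + hess_form h k f x.
Proof.
move=> Cf Ch Dx; rewrite grad_dot_sum.
under eq_bigr => c _ do rewrite (partial_grad_dot c Cf Ch Dx) mulrDr.
rewrite big_split/=; congr (_ + _).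
  by rewrite /hess_form -[in RHS]mulmxA [RHS]mxE.
by rewrite /hess_form -[in RHS]mulmxA [RHS]mxE.
Qed.

Opaque hess_form.

(* The Hessian is determined by the first-order form grad_dot, whose invariance
   under changes of coordinates is easy. *)
Lemma hess_form_polarization f h k x :
  Ck 2 D f -> Ck 2 D h -> Ck 2 D k -> D x ->
  2 * hess_form f h k x =
  grad_dot h (grad_dot f k) x + grad_dot k (grad_dot f h) x
  - grad_dot f (grad_dot h k) x.
Proof.
move=> Cf Ch C2k Dx.
rewrite (grad_dot_grad_dot h Cf C2k Dx) (grad_dot_grad_dot k Cf Ch Dx).
rewrite (grad_dot_grad_dot f Ch C2k Dx).
rewrite (hess_formC k h Cf Dx) (hess_formC f h C2k Dx) (hess_formC k f Ch Dx).
move: (hess_form f h k x) (hess_form k h f x) (hess_form h f k x) => p q r; ring.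
Qed.

End local_geometry.

Transparent covariant_derivative gradient hessian hess_form.

(** * Changes of coordinates *)


Lemma sqnorm_endo_conj (R : rcfType) n (J G H : 'M[R]_n) :
  J \in unitmx -> G \in unitmx ->
  sqnorm_endo (J *m G *m J^T) (J *m H *m invmx J) = sqnorm_endo G H.
Proof.
move=> Ju Gu; rewrite /sqnorm_endo.
have JTu : J^T \in unitmx by rewrite unitmx_tr.
rewrite !invmx_mulmx ?unitmx_mul ?Ju//.
have -> : J *m H *m invmx J *m (J *m G *m J^T) = J *m (H *m G) *m J^T.
  by rewrite !mulmxA mulmxKV.
have -> : (J *m H *m invmx J)^T = invmx J^T *m H^T *m J^T.
  by rewrite !trmx_mul trmx_inv !mulmxA.
rewrite -!mulmxA mxtrace_mulC !mulmxA mulmxK// mulmxK//.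
by rewrite mulmxKV.
Qed.

Section change_of_coordinates.
Context {R : realType} {n : nat}.
Variables (D E : set 'rV[R]_n) (tau : 'rV[R]_n -> 'rV[R]_n).
Variables (G G' : 'rV[R]_n -> 'M[R]_n).
Hypotheses (oD : open D) (oE : open E) (DE : forall x, D x -> E (tau x)).
Hypothesis tauC : forall c, Ck 2 D (fun y => tau y 0 c).
Hypotheses (GC : forall i j, Ck 1 D (fun y => G y i j))
  (GC' : forall i j, Ck 1 E (fun y => G' y i j)).
Hypotheses (Gpd : forall x, D x -> posdef (G x))
  (Gpd' : forall x, E x -> posdef (G' x)).
Hypothesis isom : forall x, D x -> G x = 'J tau x *m G' (tau x) *m ('J tau x)^T.
Implicit Types f h k : 'rV[R]_n -> R.

Let dtau x : D x -> differentiable tau x.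
Proof.
by move=> Dx; apply: differentiable_rV => c; exact: Ck_differentiable (tauC c) Dx.
Qed.

Let CkT f : Ck 2 E f -> Ck 2 D (f \o tau).
Proof. exact: Ck_comp. Qed.

Lemma jacobian_unit x : D x -> 'J tau x \in unitmx.
Proof.
move=> Dx; have := posdef_unit (Gpd Dx).
by rewrite (isom Dx) -mulmxA unitmx_mul => /andP[].
Qed.

Lemma differential_comp f x : D x -> differentiable f (tau x) ->
  differential (f \o tau) x = differential f (tau x) *m ('J tau x)^T.
Proof.
move=> Dx df; apply/rowP => j; rewrite mxE (partial_comp _ (dtau Dx) df) mxE.
by apply: eq_bigr => c _; rewrite [_^T _ _]mxE [differential _ _ _ _]mxE mulrC.
Qed.

Lemma gradient_comp f x : D x -> differentiable f (tau x) ->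
  gradient G (f \o tau) x *m 'J tau x = gradient G' f (tau x).
Proof.
move=> Dx df; have Ju := jacobian_unit Dx.
have G'u := posdef_unit (Gpd' (DE Dx)).
have u : G' (tau x) *m ('J tau x)^T \in unitmx by rewrite unitmx_mul G'u unitmx_tr.
(* Multiplied by [G' J^T], both sides become differentials, and the isometry relation [isom]
   applies. *)
apply: (can_inj (mulmxK u)); rewrite [RHS]mulmxA (gradient_metric Gpd' f (DE Dx)).
rewrite -differential_comp// -(gradient_metric Gpd (f \o tau) Dx) (isom Dx).
by rewrite !mulmxA.
Qed.

Lemma grad_dot_comp f h x : D x ->
  differentiable f (tau x) -> differentiable h (tau x) ->
  grad_dot G (f \o tau) (h \o tau) x = grad_dot G' f h (tau x).
Proof.
move=> Dx df dh; rewrite [LHS]/grad_dot [RHS]/grad_dot differential_comp// trmx_mul trmxK mulmxA.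
by rewrite gradient_comp.
Qed.

Lemma grad_dot_grad_dot_comp f h k x : D x ->
  Ck 2 E f -> Ck 2 E h -> Ck 2 E k ->
  grad_dot G (f \o tau) (grad_dot G (h \o tau) (k \o tau)) x =
  grad_dot G' f (grad_dot G' h k) (tau x).
Proof.
move=> Dx Cf Ch C2k.
have dE p y : Ck 2 E p -> D y -> differentiable p (tau y).
  by move=> Cp /DE Ey; exact: Ck_differentiable Cp Ey.
rewrite (grad_dot_near_eq G (f \o tau) (h' := grad_dot G' h k \o tau)).
  rewrite grad_dot_comp//; first exact: dE.
  exact: (Ck_differentiable (@Ck_grad_dot _ _ _ _ oE GC' Gpd' 1 h k isT Ch C2k) (DE Dx)).
apply: filterS (open_nbhs_nbhs (conj oD Dx)) => y Dy.
by rewrite grad_dot_comp//; exact: dE.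
Qed.

Lemma hess_form_comp f h k x : D x ->
  Ck 2 E f -> Ck 2 E h -> Ck 2 E k ->
  hess_form G (f \o tau) (h \o tau) (k \o tau) x = hess_form G' f h k (tau x).
Proof.
move=> Dx Cf Ch C2k; apply: (@mulfI _ 2); first by rewrite pnatr_eq0.
rewrite (hess_form_polarization oD GC Gpd (CkT Cf) (CkT Ch) (CkT C2k) Dx).
rewrite (hess_form_polarization oE GC' Gpd' Cf Ch C2k (DE Dx)).
by rewrite !grad_dot_grad_dot_comp.
Qed.

(** Tested on pairs of coordinate functions: their gradients are rows of the inverse Gram matrix, so
    [hess_form] yields the entries of the inverse Gram matrix times the Hessian, and its invariance
    gives the conjugation without computing second derivatives of [tau]. *)
Lemma hessian_comp f x : D x -> Ck 2 E f ->
  hessian G (f \o tau) x = 'J tau x *m hessian G' f (tau x) *m invmx ('J tau x).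
Proof.
move=> Dx Cf; have Ju := jacobian_unit Dx; have Ex := DE Dx.
have G'u := posdef_unit (Gpd' Ex).
set J := 'J tau x in Ju *; set H := hessian G _ x; set H' := hessian G' f _.
suff KE : invmx J *m H *m J = H' by rewrite -KE !mulmxA mulmxK// mulmxV// mul1mx.
apply: (can_inj (mulKmx (_ : invmx (G' (tau x)) \in unitmx))); first by rewrite unitmx_inv.
apply/matrixP => c d.
pose h (y : 'rV[R]_n) := y 0 c; pose k (y : 'rV[R]_n) := y 0 d.
have Ch : Ck 2 E h by exact: Ck_coordinate.
have C2k : Ck 2 E k by exact: Ck_coordinate.
have dc e y : differential (fun y : 'rV[R]_n => y 0 e) y = delta_mx 0 e.
  by apply/rowP => j; rewrite mxE partial_coordinate.
have dh : differentiable h (tau x) by exact: differentiable_coord.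
have dk : differentiable k (tau x) by exact: differentiable_coord.
have gradh : gradient G' h (tau x) = delta_mx 0 c *m invmx (G' (tau x)).
  by rewrite -(dc c (tau x)).
have E1 : hess_form G (f \o tau) (h \o tau) (k \o tau) x =
    (invmx (G' (tau x)) *m (invmx J *m H *m J)) c d.
  have gh : gradient G (h \o tau) x = delta_mx 0 c *m invmx (G' (tau x)) *m invmx J.
    by rewrite -gradh -(gradient_comp Dx dh) mulmxK.
  have gk : G x *m (gradient G (k \o tau) x)^T = J *m (delta_mx 0 d)^T.
    rewrite -{1}(Gpd Dx).1 -trmx_mul (gradient_metric Gpd _ Dx) differential_comp//.
    by rewrite trmx_mul trmxK dc.
  rewrite /hess_form gh -/H -!mulmxA gk !mulmxA -!(mulmxA (delta_mx 0 c)) -rowE.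
  by rewrite trmx_delta -colE mxE mxE.
have E2 : hess_form G' f h k (tau x) = (invmx (G' (tau x)) *m H') c d.
  have gk : G' (tau x) *m (gradient G' k (tau x))^T = (delta_mx 0 d)^T.
    by rewrite -{1}(Gpd' Ex).1 -trmx_mul (gradient_metric Gpd' _ Ex) dc.
  rewrite /hess_form gradh -/H' -!mulmxA gk !mulmxA -!(mulmxA (delta_mx 0 c)) -rowE.
  by rewrite trmx_delta -colE mxE mxE.
by rewrite -E1 -E2 hess_form_comp.
Qed.

Lemma sqnorm_hessian_comp f x : D x -> Ck 2 E f ->
  sqnorm_endo (G x) (hessian G (f \o tau) x) =
  sqnorm_endo (G' (tau x)) (hessian G' f (tau x)).
Proof.
move=> Dx Cf; rewrite (hessian_comp Dx Cf) (isom Dx) sqnorm_endo_conj//.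
  exact: jacobian_unit.
exact: posdef_unit (Gpd' (DE Dx)).
Qed.

End change_of_coordinates.

(** * Hessians of logarithms and square roots *)

Section log_hessian.
Context {R : realType} {n : nat}.
Variables (D : set 'rV[R]_n) (G : 'rV[R]_n -> 'M[R]_n).
Hypothesis oD : open D.
Hypothesis GC : forall i j, Ck 1 D (fun y => G y i j).
Hypothesis Gpd : forall x, D x -> posdef (G x).
Variable u : 'rV[R]_n -> R.
Hypotheses (uC : Ck 2 D u) (u0 : forall x, D x -> 0 < u x).

Local Notation phi := (fun y => ln (u y)).
Local Notation N := (grad_dot G phi phi).

Lemma grad_dotM (f h k : 'rV[R]_n -> R) (x : 'rV[R]_n) : differentiable h x -> differentiable k x ->
  grad_dot G f (fun y => h y * k y) x =
  h x * grad_dot G f k x + k x * grad_dot G f h x.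
Proof.
move=> dh dk; rewrite !grad_dot_sum !mulr_sumr -big_split; apply: eq_bigr => c _ /=.
by rewrite partialM//; ring.
Qed.

Let phiC : Ck 2 D phi. Proof. exact: Ck_ln. Qed.

Let du x : D x -> differentiable u x.
Proof. by move=> Dx; exact: Ck_differentiable uC Dx. Qed.

Lemma partial_ln b x : D x -> partial b phi x = (u x)^-1 * partial b u x.
Proof.
by move=> Dx; exact: (partial_comp1 b (du Dx) (is_derive1_ln (u0 Dx))).
Qed.

(** From du = u dphi; this is the source of the good term u N^2 in the divergence. *)
Lemma grad_dot_ln x : D x -> grad_dot G phi u x = u x * N x.
Proof.
move=> Dx; rewrite !grad_dot_sum mulr_sumr; apply: eq_bigr => c _.
by rewrite (partial_ln c Dx) mulrCA mulVKf// gt_eqF// u0.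
Qed.

(* The divergence of the vector field a u N grad(phi), written in coordinates
   with the density sqrt (det G). The constant n + 4 comes from Young's
   inequality for the terms 2 Hess(X, X) and N (Laplacian phi), X = grad(phi),
   together with (tr H)^2 <= n |H|^2. *)
Lemma divergence_log_field a x : Ck 1 D a -> D x -> 0 <= a x ->
  Num.sqrt (\det (G x)) *
   (a x * u x * (2^-1 * N x ^+ 2 - (n%:R + 4) * sqnorm_endo (G x) (hessian G phi x))
    + u x * N x * grad_dot G phi a x) <=
  \sum_b partial b (fun y => a y * u y * N y *
     (gradient G phi y 0 b * Num.sqrt (\det (G y)))) x.
Proof.
move=> Ca Dx a0; set s := Num.sqrt _; set H := hessian _ _ _.
have s0 : 0 <= s by exact: sqrtr_ge0.
have CX c : Ck 1 D (fun y => gradient G phi y 0 c) by exact: Ck_gradient.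
have CN : Ck 1 D N by exact: Ck_grad_dot.
have Cs : Ck 1 D (fun y => Num.sqrt (\det (G y))).
  apply: (Ck_sqrt oD _ (Ck_det oD GC)) => y Dy.
  exact/posdef_det_gt0/Gpd.
have da := Ck_differentiable Ca Dx.
have dN := Ck_differentiable CN Dx.
have dau : differentiable (fun y => a y * u y) x by apply: differentiableM => //; exact: du.
have dw : differentiable (fun y => a y * u y * N y) x by exact: differentiableM.
have dXs c : differentiable (fun y => gradient G phi y 0 c * Num.sqrt (\det (G y))) x.
  by apply: differentiableM; [exact: Ck_differentiable (CX c) Dx|exact: Ck_differentiable Cs Dx].
under eq_bigr => b _ do rewrite (partialM b dw (dXs b)).
rewrite big_split/= -mulr_sumr (divergence_volume oD GC Gpd Dx); last first.
  by move=> c; exact: Ck_differentiable (CX c) Dx.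
rewrite -/s -[covariant_derivative _ _ _]/H.
have -> : \sum_b gradient G phi x 0 b * s * partial b (fun y => a y * u y * N y) x =
    s * grad_dot G phi (fun y => a y * u y * N y) x.
  by rewrite grad_dot_sum mulr_sumr; apply: eq_bigr => b _; ring.
rewrite (grad_dotM _ dau dN) (grad_dotM _ da (du Dx)) (grad_dot_ln Dx).
rewrite (grad_dot_grad_dot oD GC Gpd _ phiC phiC Dx).
have := sqnorm_endo_trace_le (Gpd Dx) H (gradient G phi x).
rewrite -(grad_dotE Gpd phi phi Dx).
have -> : (gradient G phi x *m H *m G x *m (gradient G phi x)^T) 0 0 =
   hess_form G phi phi phi x by rewrite /hess_form !mulmxA.
have ux := u0 Dx.
move: (grad_dot G phi phi x) (grad_dot G phi a x) (hess_form G phi phi phi x)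
  (sqnorm_endo (G x) H) (\tr H) => N0 Ga hf S tr ineq.
(* The right side is now the exact divergence. The only loss is [ineq], multiplied by the
   nonnegative factor [a x * u x]. *)
rewrite [leRHS](_ : _ = s * (a x * u x * (2 * hf + N0 * tr) + a x * u x * N0 ^+ 2 + u x * N0 * Ga)); last by ring.
apply: ler_wpM2l => //; rewrite -subr_ge0.
rewrite (_ : _ - _ = a x * u x * (2^-1 * N0 ^+ 2 + (n%:R + 4) * S - (- (2 * hf + N0 * tr)))); last by field.
by rewrite mulr_ge0 ?subr_ge0// mulr_ge0// ltW.
Qed.

(** With c = sqrt u / 2 one has grad (sqrt u) = c grad phi and dc = (c / 2) dphi, so the Leibniz
    rule for the covariant derivative of c grad phi gives the two terms. *)
Lemma hessian_sqrt x : D x ->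
  hessian G (fun y => Num.sqrt (u y)) x =
  (2^-1 * Num.sqrt (u x)) *: (hessian G phi x
     + 2^-1 *: ((differential phi x)^T *m gradient G phi x)).
Proof.
move=> Dx; have dv b y : D y ->
    partial b (fun y => Num.sqrt (u y)) y = 2^-1 * Num.sqrt (u y) * partial b phi y.
  move=> Dy; rewrite (partial_ln b Dy).
  rewrite [LHS](partial_comp1 b (du Dy) (is_derive1_sqrt (u0 Dy))) mulrA; congr (_ * _).
  rewrite -{3}(sqr_sqrtr (ltW (u0 Dy))); field.
  by rewrite gt_eqF// sqrtr_gt0 u0.
have gradv y : D y -> gradient G (fun y => Num.sqrt (u y)) y =
    (2^-1 * Num.sqrt (u y)) *: gradient G phi y.
  move=> Dy; rewrite /gradient scalemxAl; congr (_ *m _).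
  by apply/rowP => b; rewrite !mxE dv.
have Cv : Ck 2 D (fun y => 2^-1 * Num.sqrt (u y)) by exact: (CkZ oD _ (Ck_sqrt oD u0 uC)).
have CX c : Ck 1 D (fun y => gradient G phi y 0 c) by exact: Ck_gradient.
apply/matrixP => i k; rewrite [LHS]covariant_derivativeE.
rewrite (@partial_near_eq _ _ i _ (fun y => 2^-1 * Num.sqrt (u y) * gradient G phi y 0 k) x); last first.
  by apply: filterS (open_nbhs_nbhs (conj oD Dx)) => y Dy; rewrite gradv// mxE.
rewrite (partialM i (Ck_differentiable Cv Dx) (Ck_differentiable (CX k) Dx)).
rewrite (_ : partial i (fun y => 2^-1 * Num.sqrt (u y)) x =
   2^-1 * (2^-1 * Num.sqrt (u x) * partial i phi x)); last first.
  rewrite -dv// (@partialM _ _ i (cst 2^-1) _ x (differentiable_cst _ _)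
    (Ck_differentiable (Ck_sqrt oD u0 uC) Dx)).
  by rewrite partial_cst mulr0 addr0.
rewrite [RHS]mxE [X in _ = _ * X]mxE [hessian G phi x i k]covariant_derivativeE.
rewrite [X in _ = _ * (_ + X)]mxE [X in _ = _ * (_ + _ * X)]mxE big_ord1.
rewrite [_^T _ _]mxE [differential _ _ _ _]mxE.
rewrite (gradv x Dx).
under eq_bigr => j _ do rewrite mxE mulrCA.
rewrite -mulr_sumr; ring.
Qed.

(** [hessian_sqrt] contributes the factor u / 4, [sqnorm_endoD_le] the factor 2, and the rank one
    term has squared norm N^2 / 4. *)
Lemma sqnorm_hessian_sqrt_le x : D x ->
  sqnorm_endo (G x) (hessian G (fun y => Num.sqrt (u y)) x) <=
  2^-1 * (u x * sqnorm_endo (G x) (hessian G phi x)) + 8^-1 * (u x * N x ^+ 2).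
Proof.
move=> Dx; rewrite (hessian_sqrt Dx) (sqnorm_endoZ (Gpd Dx)).
have := sqnorm_endoD_le (Gpd Dx) (hessian G phi x)
  (2^-1 *: ((differential phi x)^T *m gradient G phi x)).
rewrite (sqnorm_endoZ (Gpd Dx)) (sqnorm_endo_rank1 (Gpd Dx)) -/(gradient G phi x).
rewrite -(grad_dotE Gpd phi phi Dx) exprMn sqr_sqrtr ?(ltW (u0 Dx))//.
set H := hessian G phi x; set K := 2^-1 *: _; have ux := u0 Dx.
move: (sqnorm_endo (G x) (H + K)) (sqnorm_endo (G x) H) (grad_dot G phi phi x) => a b c le1.
apply: (le_trans (ler_wpM2l (_ : 0 <= 2^-1 ^+ 2 * u x) le1)).
  by rewrite mulr_ge0// ltW.
rewrite le_eqVlt; apply/orP; left; apply/eqP; by field.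
Qed.

End log_hessian.

(** * Functions of class C^k on a manifold, partitions of unity *)

Lemma open_preimage_in (T S : topologicalType) (U : set T) (f : T -> S) (V : set S) :
  open U -> (forall x, U x -> {for x, continuous f}) -> open V ->
  open (U `&` f @^-1` V).
Proof.
move=> oU cf oV; rewrite openE => x [Ux Vx]; apply: filterI.
  exact: open_nbhs_nbhs (conj oU Ux).
exact: (cf x Ux _ (open_nbhs_nbhs (conj oV Vx))).
Qed.

Lemma smooth_on_coord (R : realType) n m k (D : set 'rV[R]_n)
    (t : 'rV[R]_n -> 'rV[R]_m) c : open D ->
  smooth_on D t -> Ck k D (fun y => t y 0 c).
Proof.
move=> oD; elim: k t => [|k IH] t st.
  move=> x Dx; apply: (@continuous_comp _ _ _ t (fun y : 'rV[R]_m => y 0 c)).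
    exact: differentiable_continuous (st [::] x Dx).
  exact: coord_continuous.
split=> [x Dx|j].
  exact: (differentiable_comp (st [::] x Dx) (differentiable_coord _ _ _)).
apply: (Ck_eq oD _ (IH (partial j t) _)).
  by move=> x Dx; rewrite partial_vector//; exact: (st [::] x Dx).
by move=> js x Dx; have := st (rcons js j) x Dx; rewrite foldr_rcons.
Qed.

(** * Bump functions of class C^1 supported in boxes of R^n *)

Section bump.
Context {R : realType}.

(** Squaring smooths the corner of the positive part: at 0 the difference quotient is 0 or h. Class
    C^1 suffices for cut-off functions that are differentiated once. *)
Lemma is_derive_sqr_max0 (s : R) :
  is_derive s 1 (fun t => Num.max 0 t ^+ 2) (2 * Num.max 0 s).
Proof.
have [s0|s0|->] := ltgtP s 0.
- rewrite mulr0.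
  apply: (@near_eq_is_derive R R R (cst 0) _ s 1 0).
  have : nbhs s [set y | y < 0] by exact: lt_nbhsl.
  by apply: filterS => y y0; rewrite max_l ?ltW// expr0n.
- apply: (@near_eq_is_derive R R R (fun t : R => t ^+ 2) _ s 1).
    have : nbhs s [set y | 0 < y] by exact: lt_nbhsr.
    by apply: filterS => y y0; rewrite max_r ?ltW.
  apply: DeriveDef; first exact: exprn_derivable.
  by rewrite exp_derive expr1 -[LHS]/(2 * s * 1) mulr1.
- rewrite mulr0.
  have L : (fun h : R => h^-1 *: (Num.max (0 : R) (h *: 1 + 0 : R) ^+ 2 - Num.max 0 0 ^+ 2))
      @ (0 : R)^' --> (0 : R).
    apply/cvgrPdist_lt => e e0; near=> h.
    have he : `|h| < e by near: h; exact: dnbhs0_lt.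
    rewrite sub0r normrN maxxx expr0n subr0 addr0 [h%:A]mulr1.
    have [h0|h0] := leP h 0; first by rewrite expr0n scaler0 normr0.
    by rewrite -[_ *: _]/(h^-1 * h ^+ 2) expr2 mulKf// gt_eqF.
  apply: DeriveDef; first by apply/cvg_ex; exists 0.
  exact: cvg_lim L.
Unshelve. all: by end_near. Qed.

Definition box_bump n (c : 'rV[R]_n) (r : R) (x : 'rV[R]_n) : R :=
  \prod_i Num.max 0 (r ^+ 2 - (x 0 i - c 0 i) ^+ 2) ^+ 2.

Lemma Ck_box_bump n (c : 'rV[R]_n) r (D : set 'rV[R]_n) : open D -> Ck 1 D (box_bump c r).
Proof.
move=> oD; apply: Ck_prod => // i.
pose f (x : 'rV[R]_n) := r ^+ 2 - (x 0 i - c 0 i) ^+ 2.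
have Cd k : Ck k D (fun x => x 0 i - c 0 i).
  by apply: CkB => //; [exact: Ck_coordinate|exact: Ck_cst].
have Cf k : Ck k D f.
  by apply: CkB => //; [exact: Ck_cst|apply: CkM].
apply: (@Ck_comp1 _ _ _ oD 0 (fun t => Num.max 0 t ^+ 2) (fun t => 2 * Num.max 0 t) f) => //.
  by move=> x _; exact: is_derive_sqr_max0.
apply: CkZ => // x Dx.
apply: (@continuous_max _ _ (cst 0) f); first exact: cst_continuous.
exact: Ck_continuous (Cf 0) Dx.
Qed.

Lemma box_bump_ge0 n (c : 'rV[R]_n) r x : 0 <= box_bump c r x.
Proof. by apply: prodr_ge0 => i _; exact: sqr_ge0. Qed.

Lemma box_bump_center n (c : 'rV[R]_n) r : 0 < r -> 0 < box_bump c r c.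
Proof.
move=> r0; apply: prodr_gt0 => i _.
by rewrite subrr expr0n subr0 max_r ?sqr_ge0// exprn_gt0// exprn_gt0.
Qed.

Definition box n (c : 'rV[R]_n) (r : R) : set 'rV[R]_n :=
  [set x | forall i, `|x 0 i - c 0 i| <= r].

Lemma box_bump_supp n (c : 'rV[R]_n) r x : 0 < r -> box_bump c r x != 0 -> box c r x.
Proof.
move=> r0 bx i; rewrite leNgt; apply: contra bx => ri.
rewrite /box_bump (bigD1 i)//= max_l ?expr0n ?mul0r// subr_le0.
by rewrite -[leRHS]real_normK ?num_real// lerXn2r ?nnegrE// ltW.
Qed.

Lemma compact_box n (c : 'rV[R]_n) r : compact (box c r).
Proof.
rewrite (_ : box c r = [set v : 'rV[R]_n | forall i, `[c 0 i - r, c 0 i + r]%classic (v ord0 i)]).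
  exact: (@rV_compact R n (fun i => `[c 0 i - r, c 0 i + r]%classic) (fun=> @segment_compact _ _ _)).
by apply/seteqP; split => v vb i; have := vb i; rewrite /= in_itv/= ler_distl.
Qed.

Lemma box_nbhs n (U : set 'rV[R]_n) x : open U -> U x ->
  exists2 r, 0 < r & box x r `<=` U.
Proof.
move=> oU Ux; have : nbhs x U by exact: open_nbhs_nbhs.
move=> /nbhs_ballP[e /= e0 eU]; exists (e / 2); first by rewrite divr_gt0.
move=> y yb; apply: eU; split => // i j; rewrite ord1 -ball_normE/= distrC.
by apply: (le_lt_trans (yb j)); rewrite ltr_pdivrMr// ltr_pMr// ltr1n.
Qed.

End bump.

Section manifold_functions.
Context {R : realType} {n : nat} {M : ptopologicalType} (A : @smooth_atlas R n M).
Implicit Types (i j : index A) (f h : M -> R).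

Lemma continuous_param_at (c : @chart R n M) x : cod c x -> {for x, continuous (param c)}.
Proof.
move=> cx; have := @continuous_param _ _ _ c; rewrite (continuous_open_subspace _ (@open_cod _ _ _ c)).
by apply; rewrite inE.
Qed.

Lemma continuous_coord_at (c : @chart R n M) p : dom c p -> {for p, continuous (coord c)}.
Proof.
move=> cx; have := @continuous_coord _ _ _ c; rewrite (continuous_open_subspace _ (@open_dom _ _ _ c)).
by apply; rewrite inE.
Qed.

Lemma open_param_preimage (c : @chart R n M) (U : set M) : open U ->
  open (cod c `&` param c @^-1` U).
Proof.
by apply: open_preimage_in; [exact: open_cod|exact: continuous_param_at].
Qed.

Definition overlap i j := cod (A i) `&` param (A i) @^-1` dom (A j).

Lemma open_overlap i j : open (overlap i j).
Proof. exact/open_param_preimage/open_dom. Qed.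

Lemma Ck_transition k i j c : Ck k (overlap i j) (fun y => transition (A i) (A j) y 0 c).
Proof.
by apply: smooth_on_coord; [exact: open_overlap|exact: smooth_transition].
Qed.

Lemma transition_cod i j x : overlap i j x -> cod (A j) (transition (A i) (A j) x).
Proof. by move=> [_ dx]; exact: coord_cod. Qed.

Lemma param_transition i j x : overlap i j x ->
  param (A j) (transition (A i) (A j) x) = param (A i) x.
Proof. by move=> [_ dx]; exact: coordK. Qed.

Definition mfdCk k f := forall i, Ck k (cod (A i)) (f \o param (A i)).

Lemma smooth_mfdCk k f : smooth A f -> mfdCk k f.
Proof. by move=> sf i; exact: smooth_on_Ck. Qed.

Lemma mfdCk_le k l f : (k <= l)%N -> mfdCk l f -> mfdCk k f.
Proof. by move=> kl Cf i; exact: Ck_le kl (Cf i). Qed.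

Lemma mfdCk_continuous k f : mfdCk k f -> continuous f.
Proof.
move=> Cf p; have [i ip] := atlas_cover A p.
have cc : {for p, continuous (f \o param (A i) \o coord (A i))}.
  apply: continuous_comp; first exact: continuous_coord_at.
  exact: Ck_continuous (Cf i) (coord_cod ip).
have near_eq : \near p, (f \o param (A i) \o coord (A i)) p = f p.
  apply: filterS (open_nbhs_nbhs (conj (@open_dom _ _ _ (A i)) ip)) => q iq /=.
  by rewrite coordK.
suff : f q @[q --> p] --> f p by [].
rewrite -[X in _ --> X](nbhs_singleton near_eq); apply: cvg_trans cc.
exact: (@near_eq_cvg _ _ (nbhs p) _ _ f near_eq).
Qed.

Lemma mfdCkM k f h : mfdCk k f -> mfdCk k h -> mfdCk k (fun p => f p * h p).
Proof. by move=> Cf Ch i; exact: (CkM (@open_cod _ _ _ (A i)) (Cf i) (Ch i)). Qed.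

Lemma mfdCkD k f h : mfdCk k f -> mfdCk k h -> mfdCk k (fun p => f p + h p).
Proof. by move=> Cf Ch i; exact: (CkD (@open_cod _ _ _ (A i)) (Cf i) (Ch i)). Qed.

Lemma mfdCk_cst k (c : R) : mfdCk k (cst c).
Proof. by move=> i; exact: (Ck_cst (@open_cod _ _ _ (A i))). Qed.

Lemma mfdCk_sum k (I : Type) (r : seq I) (F : I -> M -> R) :
  (forall a, mfdCk k (F a)) -> mfdCk k (fun p => \sum_(a <- r) F a p).
Proof. by move=> CF i; apply: (Ck_sum (@open_cod _ _ _ (A i))) => a; exact: CF. Qed.

Lemma mfdCkV k f : (forall p, f p != 0) -> mfdCk k f -> mfdCk k (fun p => (f p)^-1).
Proof. by move=> f0 Cf i; apply: (CkV (@open_cod _ _ _ (A i)) _ (Cf i)) => x _; exact: f0. Qed.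

Hypothesis hausM : hausdorff_space M.

(** The place where the Hausdorff property enters: a compact piece of a chart is closed in M, so a
    function vanishing off it vanishes near every point off it. *)
Lemma closed_param (c : @chart R n M) (K : set 'rV[R]_n) :
  compact K -> K `<=` cod c -> closed (param c @` K).
Proof.
move=> cK Kc; apply: compact_closed => //; apply: continuous_compact => //.
by apply: continuous_in_subspaceT => x; rewrite inE => /Kc; exact: continuous_param_at.
Qed.

Lemma bump_function p : exists b : M -> R, exists2 K : set 'rV[R]_n,
  compact K /\ K `<=` cod (A (index_at A p)) &
  [/\ forall q, 0 <= b q, 0 < b p, mfdCk 1 b
    & forall q, ~ (param (A (index_at A p)) @` K) q -> b q = 0].
Proof.
set i := index_at A p; have ip := dom_index_at A p.
have [r r0 rU] := box_nbhs (@open_cod _ _ _ (A i)) (coord_cod ip).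
set c := coord (A i) p in rU; pose K := box c r.
pose b q := if `[< dom (A i) q >] then box_bump c r (coord (A i) q) else 0.
have cK := @compact_box _ _ c r.
have b0 q : ~ (param (A i) @` K) q -> b q = 0.
  rewrite /b; case: asboolP => // iq nK; apply/eqP; apply: contra_notT nK => /(box_bump_supp r0) Kq.
  by exists (coord (A i) q) => //; exact: coordK.
exists b, K => //; split => //.
- by move=> q; rewrite /b; case: ifP => // _; exact: box_bump_ge0.
- by rewrite /b asboolT//; exact: box_bump_center.
(* In another chart [j], [b] is a box bump composed with a transition map on the overlap; at a point
   outside the domain of chart [i], it vanishes on the open complement of its compact support. *)
move=> j; apply: Ck_local => x jx.
have [ix|nix] := pselect (dom (A i) (param (A j) x)).
  exists (overlap j i) => //.
  have C := Ck_comp (@open_overlap j i) (fun x H => transition_cod H)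
    (@Ck_transition 1 j i) (Ck_box_bump c r (@open_cod _ _ _ (A i))).
  apply: (Ck_eq (@open_overlap j i) _ C) => y [_ iy] /=.
  by rewrite /b asboolT.
exists (cod (A j) `&` param (A j) @^-1` (~` (param (A i) @` K))).
  split => //= -[y Ky yx]; apply: nix; rewrite -yx; apply: param_dom; exact: rU.
have oU : open (cod (A j) `&` param (A j) @^-1` (~` (param (A i) @` K))).
  by apply: open_param_preimage; apply: closed_openC; exact: closed_param.
by apply: (Ck_eq oU _ (Ck_cst oU 1 0)) => y [_ nK]; rewrite /= b0.
Qed.

(** By compactness finitely many sets where a bump function is positive cover M, so the sum [S] can
    be divided by. The functions are indexed by all points of M, each with support in its own chart;
    those of the finite list [s] sum to 1. *)
Lemma partition_of_unity : compact [set: M] ->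
  exists (s : seq M) (a : M -> M -> R), exists2 K : M -> set 'rV[R]_n,
  forall p, compact (K p) /\ K p `<=` cod (A (index_at A p)) &
  [/\ forall p q, 0 <= a p q, forall p, mfdCk 1 (a p),
      forall p q, ~ (param (A (index_at A p)) @` K p) q -> a p q = 0
    & forall q, \sum_(p <- s) a p q = 1].
Proof.
move=> compM; have [b bP] := choice bump_function.
have [K KP] := choice (fun p => let: ex_intro2 K H1 H2 := bP p in
   ex_intro (fun K => _ /\ _) K (conj H1 H2)).
rewrite compact_cover in compM.
have [||s _ scov] := compM M [set: M] (fun p => [set q | 0 < b p q]).
- move=> p _; have [_ [_ _ Cb _]] := KP p.
  rewrite (_ : [set q | _] = b p @^-1` [set y | 0 < y]) //.
  by apply: open_comp; [move=> q _; exact: mfdCk_continuous Cb q|exact: open_gt].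
- by move=> p _; exists p => //=; have [_ []] := KP p.
pose S q := \sum_(p <- finmap.enum_fset s) b p q.
have S0 q : 0 < S q.
  have [p /= ps bp] := scov q I.
  rewrite /S (big_rem p)//= ltr_pwDl// sumr_ge0// => p' _.
  by have [_ []] := KP p'.
exists (finmap.enum_fset s), (fun p q => b p q / S q), K.
  by move=> p; have [] := KP p.
split.
- by move=> p q; rewrite divr_ge0 ?(ltW (S0 q))//; have [_ []] := KP p.
- move=> p; apply: mfdCkM; first by have [_ []] := KP p.
  apply: mfdCkV => [q|]; first by rewrite gt_eqF.
  by apply: mfdCk_sum => p'; have [_ []] := KP p'.
- by move=> p q nK; have [_ [_ _ _ ->]] := KP p; rewrite ?mul0r.
- by move=> q; rewrite -mulr_suml divff// gt_eqF// S0.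
Qed.

End manifold_functions.

(** * Integration by parts over R^n *)

Section row_of_tuple.
Context {R : realType}.
Local Notation RT := (measurableTypeR R).

Definition row_of_tuple n (t : n.-tuple RT) : 'rV[R]_n := \row_j tnth t j.

(** The sigma-algebra of tuples is generated by the coordinates rather than by the topology of rows;
    an open set is the countable union of the rational cubes inside it. *)
Lemma open_row_measurable n (U : set 'rV[R]_n) : open U ->
  measurable [set t : n.-tuple RT | U (row_of_tuple t)].
Proof.
move=> oU; pose I := ('rV[rat]_n * nat)%type.
pose box (i : I) := [set t : n.-tuple RT |
  forall c, `|tnth t c - ratr (i.1 0 c)| < i.2.+1%:R^-1].
have mbox i : measurable (box i).
  rewrite (_ : box i = \bigcap_(c in [set: 'I_n]) ((fun t : n.-tuple RT => tnth t c) @^-1`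
     [set y | `|y - ratr (i.1 0 c)| < i.2.+1%:R^-1])); last first.
    by apply/seteqP; split => [t tb c _|t tb c]; [exact: tb|exact: tb].
  apply: fin_bigcap_measurable => // c _.
  rewrite -[X in measurable X]setTI; apply: (measurable_tnth c) => //.
  rewrite (_ : [set y | _] = ball (ratr (i.1 0 c) : R) i.2.+1%:R^-1); last first.
    by apply/seteqP; split => y /=; rewrite -ball_normE/= distrC.
  by apply: open_measurable; apply: ball_open; rewrite invr_gt0.
pose P (i : I) := box i `<=` [set t | U (row_of_tuple t)].
rewrite (_ : [set t | _] = \bigcup_(i in [set i | P i]) box i); last first.
  apply/seteqP; split => [t Ut|t [i Pi] /Pi//].
  have : nbhs (row_of_tuple t) U by exact: open_nbhs_nbhs.
  move=> /nbhs_ballP[e /= e0 eU].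
  (* Half of [e], because the cube is centred at a rational point near [t] and not at [t]. *)
  have e20 : 0 < e / 2 by rewrite divr_gt0.
  have [k ke] : exists k : nat, k.+1%:R^-1 < e / 2.
    have [k kP] : exists k : nat, (e / 2)^-1 < k.+1%:R by exists (Num.truncn (e / 2)^-1); exact: truncnS_gt.
    exists k; rewrite -[ltRHS]invrK ltf_pV2// posrE// invr_gt0//.
  have k0 : 0 < k.+1%:R^-1 :> R by rewrite invr_gt0.
  have rq c : exists q : rat, `|tnth t c - ratr q| < k.+1%:R^-1 :> R.
    have dd : tnth t c - k.+1%:R^-1 < tnth t c + k.+1%:R^-1 :> R.
      by rewrite ltrBlDr -addrA ltrDl addr_gt0.
    have [q /=] := rat_in_itvoo dd.
    by rewrite in_itv/= -ltr_distlC => qP; exists q.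
  pose q : 'rV[rat]_n := \row_c sval (cid (rq c)).
  exists (q, k).
    move=> s sb; apply: eU; split => // i c; rewrite ord1 !mxE.
    have := svalP (cid (rq c)); have := sb c; rewrite /= mxE => h1 h2.
    rewrite -ball_normE/=; apply: le_lt_trans (ler_distD (ratr (sval (cid (rq c)))) _ _) _.
    rewrite [ltRHS]splitr; apply: ltrD; first exact: lt_trans h2 ke.
    by rewrite distrC; exact: lt_trans h1 ke.
  by move=> c /=; rewrite mxE; exact: svalP (cid (rq c)).
rewrite bigcup_mkcond; apply: countable_bigcupT_measurable.
  exact: countableP.
by move=> i; case: ifPn.
Qed.

Lemma continuous_row_measurable n (f : 'rV[R]_n -> R) : continuous f ->
  measurable_fun setT (fun t : n.-tuple RT => f (row_of_tuple t)).
Proof.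
move=> /continuousP cf; apply: (measurability _ (measurable_realfun.RGenOpens.measurableE R)).
move=> _ [_ [a [b ->] <-]]; rewrite setTI.
exact: (open_row_measurable (cf _ (interval_open _ _))).
Qed.

Definition row_cons n (x : R) (v : 'rV[R]_n) : 'rV[R]_n.+1 :=
  \row_i if unlift ord0 i is Some j then v 0 j else x.

Lemma row_of_tuple_cons n (x : RT) (t : n.-tuple RT) :
  row_of_tuple (tuple_cons (x, t)) = row_cons x (row_of_tuple t).
Proof.
apply/rowP => i; rewrite !mxE; case: unliftP => [j|] ->.
  by rewrite tnthS mxE.
by rewrite tnth0.
Qed.

Lemma row_cons_lift n x (v : 'rV[R]_n) (j : 'I_n) : row_cons x v 0 (lift ord0 j) = v 0 j.
Proof. by rewrite mxE liftK. Qed.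

Lemma row_cons0 n x (v : 'rV[R]_n) : row_cons x v 0 ord0 = x.
Proof. by rewrite mxE unlift_none. Qed.

Lemma box_measurable n (L : R) : measurable [set t : n.-tuple RT | forall c, `|tnth t c| <= L].
Proof.
rewrite (_ : [set _ | _] = \bigcap_(c in [set: 'I_n]) ((fun t : n.-tuple RT => tnth t c) @^-1`
   `[-L, L]%classic)); last first.
  by apply/seteqP; split => [t tb c _|t tb c]; have := tb c; rewrite /= in_itv/= -ler_norml; [|exact].
apply: fin_bigcap_measurable => // c _.
by rewrite -[X in measurable X]setTI; exact: (measurable_tnth c).
Qed.

Lemma lebesgue_tuple_box_lty n (L : R) :
  (lebesgue_tuple n [set t : n.-tuple RT | forall c, (`|tnth t c| <= L)%R] < +oo)%E.
Proof.
elim: n => [|n IH]; first by rewrite /= /unit_measure diracE; case: (_ \in _); rewrite ltry.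
rewrite /= /cons_measure /pushforward.
rewrite (_ : _ @^-1` _ = `[-L, L]%classic `*` [set t : n.-tuple RT | forall c, `|tnth t c| <= L]); last first.
  apply/seteqP; split => -[x t] /=.
    move=> xt; split; first by have := xt ord0; rewrite tnth0 ler_norml in_itv.
    by move=> c; have := xt (lift ord0 c); rewrite tnthS.
  rewrite in_itv/= -ler_norml => -[xL tL] c.
  by case: (unliftP ord0 c) => [j|] ->; rewrite ?tnthS ?tnth0.
have mbox := @box_measurable n L.
rewrite product_measure1E//; apply: lte_mul_pinfty => //.
rewrite ge0_fin_numE//.
suff : (@lebesgue_measure R `[(- L)%R, L]%classic < +oo)%E by [].
by rewrite lebesgue_measure_itv/=; case: ifP => _; rewrite -?EFinB ltry.
Qed.

(** Compact support with an explicit bound, which is inherited by the slices along [row_cons]. *)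
Definition box_supported n (L : R) (f : 'rV[R]_n -> R) : Prop :=
  forall x, f x != 0 -> forall c, `|x 0 c| <= L.

Lemma box_supported_integrable n (L : R) (f : 'rV[R]_n -> R) :
  continuous f -> box_supported L f ->
  (lebesgue_tuple n).-integrable setT (fun t => (f (row_of_tuple t))%:E).
Proof.
move=> cf fL; set B := [set t : n.-tuple RT | forall c, `|tnth t c| <= L].
have mB : measurable B by exact: box_measurable.
have iB : (lebesgue_tuple n).-integrable B (EFin \o (fun t => f (row_of_tuple t))).
  apply: measurable_bounded_integrable => //; first exact: lebesgue_tuple_box_lty.
    by apply: measurable_funTS; exact: continuous_row_measurable.
  have /compact_bounded[M [Mr MP]] : compact (f @` box 0 L).
    by apply: continuous_compact; [exact: continuous_subspaceT|exact: compact_box].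
  exists M; split => // y My t tB; apply: MP => //.
  by exists (row_of_tuple t) => // c; rewrite !mxE subr0; exact: tB.
move: iB; rewrite (integrable_mkcond _ mB); congr (_.-integrable _ _).
apply/funext => t; rewrite patchE; case: ifPn => // tB; apply/esym.
(* Off [B] the restriction takes the default value [point] of the extended reals, which is 0. *)
apply/eqP; rewrite -[point]/(0%:E) eqe; apply: contraNT tB => ft.
by rewrite inE => c; have := fL _ ft c; rewrite mxE.
Qed.

Lemma box_supported_partial n (L : R) (f : 'rV[R]_n -> R) j :
  box_supported L f -> box_supported L (partial j f).
Proof.
move=> fL x px c; rewrite leNgt; apply: contra px => Lx; apply/eqP.
rewrite -[RHS](partial_cst j 0 x); apply: partial_near_eq.
have : nbhs x [set y : 'rV[R]_n | L < `|y 0 c|].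
  have cc : {for x, continuous (fun y : 'rV[R]_n => `|y 0 c|)}.
    by apply: continuous_comp; [exact: coord_continuous|exact: norm_continuous].
  exact: (cvgr_gt _ cc).
apply: filterS => y Ly; apply/eqP; apply: contraTT Ly => fy.
by rewrite -leNgt; exact: fL.
Qed.

Lemma continuous_row_consl n (v : 'rV[R]_n) : continuous (fun x : R => row_cons x v).
Proof.
move=> x; apply: continuous_rV => i.
case: (unliftP ord0 i) => [j|] ->.
  rewrite (_ : (fun y => _) = cst (v 0 j)); first exact: cst_continuous.
  by apply/funext => y; rewrite row_cons_lift.
rewrite (_ : (fun y => _) = id) => //.
by apply/funext => y; rewrite row_cons0.
Qed.

Lemma row_cons_line n (x : R) (v : 'rV[R]_n) :
  row_cons x v = row_cons 0 v + x *: delta_mx 0 ord0.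
Proof.
apply/rowP => i; rewrite [RHS]mxE [X in _ = _ + X]mxE [X in _ = _ + _ * X]mxE.
case: (unliftP ord0 i) => [j|] ->.
  by rewrite !row_cons_lift (eq_sym (lift _ _)) (negbTE (neq_lift _ _)) andbF mulr0 addr0.
by rewrite !row_cons0 !eqxx mulr1 add0r.
Qed.

Lemma is_derive_row_cons n (f : 'rV[R]_n.+1 -> R) x (v : 'rV[R]_n) :
  differentiable f (row_cons x v) ->
  is_derive x 1 (fun y => f (row_cons y v)) (partial ord0 f (row_cons x v)).
Proof.
rewrite row_cons_line => df.
rewrite (_ : (fun y => _) = (fun y => f (row_cons 0 v + y *: delta_mx 0 ord0))).
  exact: is_derive_line.
by apply/funext => y; rewrite row_cons_line.
Qed.

Transparent partial.
Lemma partial_row_cons n (f : 'rV[R]_n.+1 -> R) x (v : 'rV[R]_n) j :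
  partial j (fun w => f (row_cons x w)) v = partial (lift ord0 j) f (row_cons x v).
Proof.
have E : (fun h : R => h^-1 *: (f (row_cons x (h *: delta_mx 0 j + v)) - f (row_cons x v))) =
  (fun h : R => h^-1 *: (f (h *: delta_mx 0 (lift ord0 j) + row_cons x v) - f (row_cons x v))).
  apply/funext => h; congr (_ *: (f _ - _)); apply/rowP => i.
  rewrite [RHS]mxE [X in _ = X + _]mxE [X in _ = _ * X + _]mxE.
  case: (unliftP ord0 i) => [k|] ->.
    by rewrite !row_cons_lift !mxE (inj_eq lift_inj).
  by rewrite !row_cons0 (negbTE (neq_lift _ _)) andbF mulr0 add0r.
by rewrite /partial /derive E.
Qed.
Opaque partial.

Lemma integral_partial_row_cons n (f : 'rV[R]_n.+1 -> R) (L : R) (v : 'rV[R]_n) :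
  Ck 1 setT f -> box_supported L f ->
  (\int[lebesgue_measure]_x (partial ord0 f (row_cons x v))%:E = 0)%E.
Proof.
(* [L] may be negative; this [a] is positive and exceeds [L], so the interval from -a to a is
   nondegenerate and the function vanishes at both ends. *)
move=> Cf fL; pose a := `|L| + 1.
have a0 : 0 < a by rewrite ltr_wpDl.
have La : L < a by rewrite (le_lt_trans (ler_norm _))// ltrDl.
have f0 (x : R) : a <= `|x| -> f (row_cons x v) = 0.
  move=> ax; apply/eqP; apply: contraTT ax => /fL/(_ ord0).
  by rewrite row_cons0 -ltNge => /le_lt_trans; exact.
have kd (x : R) : is_derive x 1 (fun y => f (row_cons y v)) (partial ord0 f (row_cons x v)).
  by apply: is_derive_row_cons; exact: Ck_differentiable Cf _.
transitivity (\int[lebesgue_measure]_(x in `[(- a)%R, a]) (partial ord0 f (row_cons x v))%:E)%E.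
  rewrite [RHS]integral_mkcond; apply: eq_integral => x _; rewrite patchE; case: ifPn => // xa.
  apply/eqP; rewrite -[point]/(0%:E) eqe; apply: contraNT xa => /(box_supported_partial fL)/(_ ord0).
  rewrite row_cons0 inE/= in_itv/= -ler_norml => /le_trans; apply; exact: ltW.
rewrite (@continuous_FTC2 _ _ (fun y => f (row_cons y v))).
- by rewrite !f0 ?normrN ?ler_norm// -EFinB subrr.
- by rewrite gtrN.
- apply: continuous_subspaceT => x; apply: continuous_comp; first exact: continuous_row_consl.
  exact: (Ck_continuous (Ck_partial ord0 Cf)).
- have kc : continuous (fun y => f (row_cons y v)).
    move=> x; apply: continuous_comp; first exact: continuous_row_consl.
    exact: Ck_continuous Cf _.
  split => [x _||].
  + by have [] := kd x.
  + exact: cvg_at_right_filter (kc _).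
  + exact: cvg_at_left_filter (kc _).
- by move=> x _; rewrite derive1E; have [] := kd x.
Qed.

Lemma integral_lebesgue_tupleS n (F : n.+1.-tuple RT -> \bar R) :
  (lebesgue_tuple n.+1).-integrable setT F ->
  let m := (lebesgue_measure \x lebesgue_tuple n)%E in
  (m.-integrable setT (F \o @tuple_cons R n) /\
  \int[lebesgue_tuple n.+1]_t F t = \int[m]_p F (tuple_cons p))%E.
Proof.
move=> /integrableP[mF iF] m.
have mc := @measurable_tuple_cons R n.
have i : m.-integrable setT (F \o @tuple_cons R n).
  apply/integrableP; split.
    by apply: measurableT_comp.
  rewrite -(@ge0_integral_pushforward _ _ _ _ _ _ mc m setT (fun t => `|F t|%E))//.
  exact: measurableT_comp.
split; first exact: i.
exact: (@integral_pushforward _ _ _ _ _ _ mc m setT F mF i measurableT).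
Qed.

(** Fubini in the order that suits [j]: the first coordinate is integrated first, by the fundamental
    theorem of calculus, if it is the one differentiated, and otherwise frozen, which leaves an
    integral in one dimension less. *)
Lemma integral_partial n j (f : 'rV[R]_n -> R) (L : R) :
  Ck 1 setT f -> box_supported L f ->
  (\int[lebesgue_tuple n]_t (partial j f (row_of_tuple t))%:E = 0)%E.
Proof.
elim: n j f => [[]//|n IH] j f Cf fL.
have cg : continuous (partial j f) by move=> x; exact: (Ck_continuous (Ck_partial j Cf)).
have [ig ->] := integral_lebesgue_tupleS (box_supported_integrable cg (box_supported_partial (j := j) fL)).
case: (unliftP ord0 j) ig => [j'|] -> ig.
  rewrite -(integral12_prod_meas1 ig); apply: integral0_eq => x _; rewrite /fubini_F/=.
  under eq_integral do rewrite row_of_tuple_cons -partial_row_cons.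
  apply: IH.
    have cc (c : 'I_n.+1) : Ck 1 setT (fun v : 'rV[R]_n => row_cons x v 0 c).
      case: (unliftP ord0 c) => [c'|] ->.
        apply: (Ck_eq openT _ (Ck_coordinate openT 1 c')) => v _.
        by rewrite row_cons_lift.
      by apply: (Ck_eq openT _ (Ck_cst openT 1 x)) => v _; rewrite row_cons0.
    exact: (@Ck_comp _ _ _ _ _ setT _ _ openT _ cc Cf).
  by move=> v fv c; have := fL _ fv (lift ord0 c); rewrite row_cons_lift.
rewrite -(integral21_prod_meas1 ig); apply: integral0_eq => t _; rewrite /fubini_G/=.
under eq_integral do rewrite row_of_tuple_cons.
exact: integral_partial_row_cons Cf fL.
Qed.

End row_of_tuple.

(** * The Riemannian volume in a chart *)

Section density_pushforward.
Context d1 d2 (X : measurableType d1) (Y : measurableType d2) (R : realType).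
Variables (mu : {measure set X -> \bar R}) (nu : {measure set Y -> \bar R}).
Variables (psi : X -> Y) (w : X -> R) (D : set Y).
Hypotheses (mpsi : measurable_fun setT psi) (mw : measurable_fun setT w).
Hypotheses (w0 : forall x, 0 <= w x).
Hypothesis nuE : forall B, measurable B -> B `<=` D ->
  nu B = (\int[mu]_x (w x * \1_B (psi x))%:E)%E.
Local Open Scope ereal_scope.

Import HBNNSimple.

Let integral_density_nnsfun (h : {nnsfun Y >-> R}) :
  (forall y, ~ D y -> h y = 0%R) ->
  \int[nu]_y (h y)%:E = \int[mu]_x ((w x)%:E * (h (psi x))%:E).
Proof.
move=> hD.
have mwi r : measurable_fun setT (fun x => (w x * \1_(h @^-1` [set r]) (psi x))%:E).
  apply/measurable_EFinP/measurable_funM => //.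
  by apply: measurableT_comp => //.
under [LHS]eq_integral do rewrite fimfunE -fsumEFin//.
rewrite [LHS]ge0_integral_fsum//; last 2 first.
  - by move=> r; exact/measurable_EFinP/measurableT_comp.
  - by move=> n x _; rewrite EFinM nnfun_muleindic_ge0.
under [RHS]eq_integral.
  move=> x _; rewrite fimfunE -fsumEFin// ge0_mule_fsumr; last first.
    by move=> r; rewrite EFinM nnfun_muleindic_ge0.
  over.
rewrite [RHS]ge0_integral_fsum//; last 2 first.
  - move=> r; under eq_fun do rewrite -EFinM mulrCA EFinM.
    exact: measurable_funeM.
  - by move=> n x _; rewrite mule_ge0 ?lee_fin// -lee_fin EFinM nnfun_muleindic_ge0.
apply: eq_fsbigr => r _; rewrite integralZl_indic_nnsfun// integral_indic// setIT.
(* The level set of 0 contains the complement of [D], where [nuE] says nothing, but it has weight 0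
   on both sides. All other level sets lie in [D]. *)
have [->|r0] := eqVneq r 0%R.
  by rewrite mul0e; under eq_integral do rewrite mul0r mule0; rewrite integral0.
rewrite nuE//; last first.
  by move=> y /= hy; apply: contrapT => /hD; rewrite hy; exact/eqP.
(* Level sets of negative values are empty; [ge0_integralZl] needs a nonnegative integrand. *)
have [rlt|rge] := ltP r 0%R.
  have e0 y : \1_(h @^-1` [set r]) y = 0%R :> R.
    rewrite indicE memNset//= => hy; suff : (0 <= r)%R by rewrite leNgt rlt.
    by rewrite -hy; exact: fun_ge0.
  under eq_integral do rewrite e0 mulr0.
  rewrite integral0 mule0; under eq_integral do rewrite e0 mulr0 mule0.
  by rewrite integral0.
rewrite -ge0_integralZl//.
  by apply: eq_integral => x _; rewrite -!EFinM mulrCA.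
by move=> x _; rewrite lee_fin mulr_ge0.
Qed.

(** Monotone convergence from simple functions: the approximations lie between 0 and [f], so they
    too vanish off [D]. *)
Lemma ge0_integral_density_pushforward (f : Y -> \bar R) :
  measurable_fun setT f -> (forall y, 0 <= f y) -> (forall y, ~ D y -> f y = 0) ->
  \int[nu]_y f y = \int[mu]_x ((w x)%:E * f (psi x)).
Proof.
move=> mf f0 fD; pose f_ := nnsfun_approx measurableT mf.
have f_le n y : (f_ n y)%:E <= f y.
  by rewrite /f_ nnsfun_approxE; apply: le_approx.
have f_nd y : {homo (fun n => (f_ n y)%:E) : n m / (n <= m)%N >-> n <= m}.
  by move=> m n mn; rewrite lee_fin; exact/lefP/nd_nnsfun_approx.
have f_cvg y : (f_ n y)%:E @[n --> \oo] --> f y.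
  exact: (cvg_nnsfun_approx measurableT mf (fun x _ => f0 x)).
transitivity (limn (fun n => \int[nu]_y (f_ n y)%:E)).
  rewrite -monotone_convergence//.
  - by apply: eq_integral => y _; apply/esym/cvg_lim => //; exact: f_cvg.
  - by move=> n; exact/measurable_EFinP/measurable_funP.
  - by move=> n y _; rewrite lee_fin.
transitivity (limn (fun n => \int[mu]_x ((w x)%:E * (f_ n (psi x))%:E))).
  congr (limn _); apply/funext => n; apply: integral_density_nnsfun => y /fD fy.
  have := f_le n y; rewrite fy lee_fin => le0.
  by apply/eqP; rewrite eq_le le0; exact: fun_ge0.
rewrite -monotone_convergence//.
- apply: eq_integral => x _; apply/cvg_lim => //.
  by apply: cvgeZl => //; exact: f_cvg.
- move=> n; apply/measurable_EFinP/measurable_funM => //.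
  exact: measurableT_comp.
- by move=> n x _; rewrite mule_ge0 ?lee_fin.
- by move=> x _ m n mn; apply: lee_wpmul2l; rewrite ?lee_fin//; exact: f_nd.
Qed.

Lemma integral_density_pushforward (f : Y -> \bar R) :
  measurable_fun setT f -> (forall y, ~ D y -> f y = 0) ->
  \int[nu]_y f y = \int[mu]_x ((w x)%:E * f (psi x)).
Proof.
move=> mf fD; rewrite integralE [RHS]integralE; congr (_ - _).
  rewrite ge0_integral_density_pushforward//.
  - by apply: eq_integral => x _; rewrite !funeposE maxe_pMr ?lee_fin// mule0.
  - exact: measurable_funepos.
  - by move=> y /fD fy; rewrite funeposE fy maxxx.
rewrite ge0_integral_density_pushforward//.
- by apply: eq_integral => x _; rewrite !funenegE -muleN maxe_pMr ?lee_fin// mule0.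
- exact: measurable_funeneg.
- by move=> y /fD fy; rewrite funenegE fy oppe0 maxxx.
Qed.

End density_pushforward.

Lemma open_piecewise_measurable (R : realType) n (S : topologicalType)
    (U : set 'rV[R]_n) (f : 'rV[R]_n -> S) (c : S) (V : set S) :
  open U -> (forall x, U x -> {for x, continuous f}) -> open V ->
  measurable [set t : n.-tuple (measurableTypeR R) |
    V (if `[< U (row_of_tuple t) >] then f (row_of_tuple t) else c)].
Proof.
move=> oU cf oV.
have mUV := open_row_measurable (open_preimage_in oU cf oV).
have mU := open_row_measurable oU.
rewrite (_ : [set t | _] = [set t | (U `&` f @^-1` V) (row_of_tuple t)] `|`
   (~` [set t | U (row_of_tuple t)] `&` [set t | V c])); last first.
  apply/seteqP; split => t /=.
    by case: asboolP => Ut Vt; [left|right].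
  by case=> [[Ut Vt]|[nUt Vc]]; [rewrite asboolT|rewrite asboolF].
apply: measurableU => //; apply: measurableI; first exact: measurableC.
have [Vc|nVc] := pselect (V c).
  by rewrite (_ : [set t | V c] = setT)//; apply/seteqP; split.
by rewrite (_ : [set t | V c] = set0)//; apply/seteqP; split.
Qed.

Section chart_integral.
Context {R : realType} {n : nat} {M : ptopologicalType} {A : @smooth_atlas R n M}.
Variable g : riemannian_metric A.
Local Notation borelM := (g_sigma_algebraType (@open M)).
Variable vol : {measure set borelM -> \bar R}.
Hypothesis hvol : is_riemannian_volume g vol.

Lemma gram_posdef (i : index A) x : cod (A i) x -> posdef (g i x).
Proof.
by move=> ix; split; [exact: gram_sym|move=> v v0; exact: gram_gt0].
Qed.

Lemma gram_Ck k (i : index A) a b : Ck k (cod (A i)) (fun x => g i x a b).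
Proof. exact/smooth_on_Ck/smooth_gram. Qed.

Lemma volume_density_Ck k (i : index A) :
  Ck k (cod (A i)) (fun x => Num.sqrt (\det (g i x))).
Proof.
apply: (Ck_sqrt (@open_cod _ _ _ (A i))).
  by move=> x ix; exact/posdef_det_gt0/gram_posdef.
exact: (Ck_det (@open_cod _ _ _ (A i)) (gram_Ck k i)).
Qed.

Lemma borel_open (U : set M) : open U -> (@open M).-sigma.-measurable U.
Proof. by move=> oU; exact: sub_sigma_algebra. Qed.

Lemma borel_continuous (f : M -> R) : continuous f ->
  measurable_fun setT (f : borelM -> R).
Proof.
move=> /continuousP cf; apply: (measurability _ (measurable_realfun.RGenOpens.measurableE R)).
move=> _ [_ [a [b ->] <-]]; rewrite setTI.
exact: (borel_open (cf _ (interval_open _ _))).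
Qed.

Definition chart_density (i : index A) (f : M -> R) (x : 'rV[R]_n) : R :=
  if `[< cod (A i) x >] then f (param (A i) x) * Num.sqrt (\det (g i x)) else 0.

Lemma integral_chart (i : index A) (f : M -> R) :
  continuous f -> (forall p, ~ dom (A i) p -> f p = 0) ->
  (\int[vol]_p (f p)%:E =
   \int[lebesgue_tuple n]_t (chart_density i f (row_of_tuple t))%:E)%E.
Proof.
move=> cf fD; have oc := @open_cod _ _ _ (A i).
(* Outside the coordinate set [psi] takes the arbitrary value [point], which may lie in the chart
   domain; the weight [w] is 0 there. *)
pose psi (t : n.-tuple (measurableTypeR R)) : borelM :=
  if `[< cod (A i) (row_of_tuple t) >] then param (A i) (row_of_tuple t) else point.
pose w (t : n.-tuple (measurableTypeR R)) : R :=
  if `[< cod (A i) (row_of_tuple t) >] then Num.sqrt (\det (g i (row_of_tuple t))) else 0.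
have mpsi : measurable_fun setT psi.
  apply: (@measurability _ _ _ borelM setT psi (@open M)) => //.
  move=> _ [U oU <-]; rewrite setTI.
  by apply: open_piecewise_measurable => // x ix; exact: continuous_param_at.
have mw : measurable_fun setT w.
  apply: (measurability _ (measurable_realfun.RGenOpens.measurableE R)).
  move=> _ [_ [a [b ->] <-]]; rewrite setTI.
  apply: (@open_piecewise_measurable _ _ R _ (fun x => Num.sqrt (\det (g i x)))) => //.
  by move=> x ix; exact: Ck_continuous (volume_density_Ck 0 i) ix.
have w0 t : 0 <= w t by rewrite /w; case: ifP.
rewrite (@integral_density_pushforward _ _ _ _ _ (lebesgue_tuple n) vol psi w (dom (A i)) mpsi mw w0)//.
- apply: eq_integral => t _; rewrite -EFinM /chart_density /w /psi.
  by case: ifP => _; rewrite ?mul0r// mulrC.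
- move=> B mB BD; rewrite (hvol mB BD).
  rewrite [LHS]integral_mkcond; apply: eq_integral => t _; rewrite patchE /w /psi /row_of_tuple.
  case: asboolP => ct; last first.
    by rewrite memNset ?mul0r// => -[].
  case: ifPn => [|nB]; first by rewrite inE/= => -[_ Bt]; rewrite indicE mem_set// mulr1.
  rewrite indicE memNset ?mulr0// => Bt.
  by move: nB; rewrite notin_setE /= => /not_andP[].
- by apply/measurable_EFinP; apply: (borel_continuous cf).
- by move=> p /fD ->.
Qed.

End chart_integral.

(** * Gradients and Hessians on a manifold *)

Section metric_operators.
Context {R : realType} {n : nat} {M : ptopologicalType} {A : @smooth_atlas R n M}.
Variable g : riemannian_metric A.
Implicit Types (i j : index A) (f h : M -> R) (p : M).

Definition mfd_grad_dot f h p : R :=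
  let i := index_at A p in
  grad_dot (g i) (f \o param (A i)) (h \o param (A i)) (coord (A i) p).

Lemma transition_gram i j x : overlap i j x ->
  g i x = 'J (transition (A i) (A j)) x *m g j (transition (A i) (A j) x)
          *m ('J (transition (A i) (A j)) x)^T.
Proof. by move=> [ix jx]; exact: gram_transition. Qed.

Lemma near_overlap f i j x : overlap i j x ->
  \near x, (f \o param (A i)) x = ((f \o param (A j)) \o transition (A i) (A j)) x.
Proof.
move=> ox; apply: filterS (open_nbhs_nbhs (conj (@open_overlap _ _ _ _ i j) ox)) => y oy /=.
by rewrite param_transition.
Qed.

Lemma overlap_coord i j p : dom (A i) p -> dom (A j) p -> overlap i j (coord (A i) p).
Proof. by move=> ip jp; split; [exact: coord_cod|rewrite /= coordK]. Qed.

Lemma transition_coord i j p : dom (A i) p ->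
  transition (A i) (A j) (coord (A i) p) = coord (A j) p.
Proof. by move=> ip; rewrite /transition /= coordK. Qed.

Lemma overlap_posdef i j x : overlap i j x -> posdef (g i x).
Proof. by move=> [ix _]; exact: gram_posdef. Qed.

Lemma mfd_grad_dot_chart i f h p : mfdCk A 1 f -> mfdCk A 1 h -> dom (A i) p ->
  mfd_grad_dot f h p = grad_dot (g i) (f \o param (A i)) (h \o param (A i)) (coord (A i) p).
Proof.
move=> Cf Ch ip; set j := index_at A p; have jp := dom_index_at A p : dom (A j) p.
have ox := overlap_coord ip jp.
have df f' : mfdCk A 1 f' -> differentiable (f' \o param (A j)) (coord (A j) p).
  by move=> Cf'; exact: Ck_differentiable (Cf' j) (coord_cod jp).
rewrite (grad_dot_near_eq _ _ (near_overlap h ox)).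
(* [grad_dot_near_eq] changes the second argument only; symmetry brings the first one into that
   place and back. *)
rewrite (grad_dotC (fun x (ox : overlap i j x) => overlap_posdef ox))//.
rewrite (grad_dot_near_eq _ _ (near_overlap f ox)).
rewrite (grad_dotC (fun x (ox : overlap i j x) => overlap_posdef ox))//.
rewrite (grad_dot_comp (fun x (ox : overlap i j x) => transition_cod ox)
  (fun c => @Ck_transition _ _ _ A 2 i j c) (fun x (ox : overlap i j x) => overlap_posdef ox)
  (fun x jx => gram_posdef g jx) (fun x (ox : overlap i j x) => transition_gram ox) ox);
  by rewrite transition_coord//; exact: df.
Qed.

(** Independence of the chart: it makes the integrand continuous although the chart in its
    definition jumps with the point, and lets it be compared with a divergence in a fixed chart. *)
Lemma hessian_sqnorm_chart i f p : mfdCk A 2 f -> dom (A i) p ->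
  hessian_sqnorm g f p = sqnorm_endo (g i (coord (A i) p))
    (hessian (g i) (f \o param (A i)) (coord (A i) p)).
Proof.
move=> Cf ip; set j := index_at A p; have jp := dom_index_at A p : dom (A j) p.
have ox := overlap_coord ip jp.
have fE y : overlap i j y -> (f \o param (A i)) y =
    ((f \o param (A j)) \o transition (A i) (A j)) y.
  by move=> oy /=; rewrite param_transition.
rewrite (eq_hessian (g i) (@open_overlap _ _ _ _ i j) fE ox).
rewrite (sqnorm_hessian_comp (@open_overlap _ _ _ _ i j) (@open_cod _ _ _ (A j))
  (fun x (ox : overlap i j x) => transition_cod ox)
  (fun c => @Ck_transition _ _ _ A 2 i j c)
  (fun a b => Ck_subset (@subIsetl _ _ _) (gram_Ck g 1 i a b))
  (gram_Ck g 1 j) (fun x (ox : overlap i j x) => overlap_posdef ox)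
  (fun x jx => gram_posdef g jx) (fun x (ox : overlap i j x) => transition_gram ox)
  ox (Cf j)).
by rewrite transition_coord.
Qed.

Lemma mfd_grad_dot_param i f h x : mfdCk A 1 f -> mfdCk A 1 h -> cod (A i) x ->
  mfd_grad_dot f h (param (A i) x) = grad_dot (g i) (f \o param (A i)) (h \o param (A i)) x.
Proof. by move=> Cf Ch ix; rewrite (mfd_grad_dot_chart Cf Ch (param_dom ix)) paramK. Qed.

Lemma hessian_sqnorm_param i f x : mfdCk A 2 f -> cod (A i) x ->
  hessian_sqnorm g f (param (A i) x) =
  sqnorm_endo (g i x) (hessian (g i) (f \o param (A i)) x).
Proof. by move=> Cf ix; rewrite (hessian_sqnorm_chart Cf (param_dom ix)) paramK. Qed.

Lemma mfdCk_mfd_grad_dot k f h : (k <= 1)%N -> mfdCk A k.+1 f -> mfdCk A k.+1 h ->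
  mfdCk A k (mfd_grad_dot f h).
Proof.
move=> k1 Cf Ch i; have oc := @open_cod _ _ _ (A i).
apply: (Ck_eq oc _ (Ck_grad_dot oc (gram_Ck g 1 i) (fun x ix => gram_posdef g ix) k1 (Cf i) (Ch i))).
by move=> x ix; rewrite /= mfd_grad_dot_param//; exact: mfdCk_le (ltn0Sn k) _.
Qed.

Lemma mfdCk_hessian_sqnorm f : mfdCk A 2 f -> mfdCk A 0 (hessian_sqnorm g f).
Proof.
move=> Cf i; have oc := @open_cod _ _ _ (A i).
apply: (@Ck_eq _ _ _ _ _ _ oc _ (@Ck_sqnorm_hessian _ _ _ _ oc (gram_Ck g 1 i)
  (fun x ix => gram_posdef g ix) _ (Cf i))).
by move=> x ix; rewrite /= hessian_sqnorm_param.
Qed.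

Lemma mfd_grad_dot_sum (I : Type) (s : seq I) f (a : I -> M -> R) p :
  (forall k, mfdCk A 1 (a k)) ->
  mfd_grad_dot f (fun q => \sum_(k <- s) a k q) p = \sum_(k <- s) mfd_grad_dot f (a k) p.
Proof.
move=> Ca; rewrite /mfd_grad_dot; set i := index_at A p.
have ip := coord_cod (dom_index_at A p).
under eq_bigr => k _ do rewrite grad_dot_sum.
rewrite grad_dot_sum exchange_big; apply: eq_bigr => c _ /=.
rewrite -mulr_sumr; congr (_ * _).
rewrite -[RHS]partial_sum//.
by move=> k; exact: Ck_differentiable (Ca k i) ip.
Qed.

Lemma mfd_grad_dot_near_cst f h p c : (\near p, h p = c) -> mfd_grad_dot f h p = 0.
Proof.
move=> hc; rewrite /mfd_grad_dot grad_dot_sum big1// => b _.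
have ip := dom_index_at A p; set i := index_at A p in ip *.
rewrite -[X in _ * X](partial_near_eq _ (f := cst c)) ?partial_cst ?mulr0//.
have cp := continuous_param_at (coord_cod ip).
move: hc; rewrite -{1}(coordK ip) => hc.
have H : nbhs (coord (A i) p) (param (A i) @^-1` [set q | h q = c]) := cp _ hc.
by apply: filterS H => x /= ->.
Qed.

Section positive_function.
Variable u : M -> R.
Hypotheses (uC : mfdCk A 2 u) (u0 : forall p, 0 < u p).

Lemma mfdCk_ln : mfdCk A 2 (fun q => ln (u q)).
Proof. by move=> i; exact: (Ck_ln (@open_cod _ _ _ (A i)) (fun x _ => u0 _) (uC i)). Qed.

Lemma mfdCk_sqrt : mfdCk A 2 (fun q => Num.sqrt (u q)).
Proof. by move=> i; exact: (Ck_sqrt (@open_cod _ _ _ (A i)) (fun x _ => u0 _) (uC i)). Qed.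

Lemma hessian_sqnorm_sqrt_le p :
  hessian_sqnorm g (fun q => Num.sqrt (u q)) p <=
  2^-1 * (u p * hessian_sqnorm g (fun q => ln (u q)) p)
  + 8^-1 * (u p * mfd_grad_dot (fun q => ln (u q)) (fun q => ln (u q)) p ^+ 2).
Proof.
have ip := dom_index_at A p; set i := index_at A p in ip.
have := sqnorm_hessian_sqrt_le (@open_cod _ _ _ (A i)) (gram_Ck g 1 i)
  (fun x ix => gram_posdef g ix) (uC i) (fun x _ => u0 _) (coord_cod ip).
by rewrite /= !coordK.
Qed.

End positive_function.
End metric_operators.

Lemma integral_EFin_sum d (T : measurableType d) (R : realType)
    (mu : {measure set T -> \bar R}) (I : Type) (s : seq I) (f : I -> T -> R) :
  (forall k, mu.-integrable setT (EFin \o f k)) ->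
  (\int[mu]_x (\sum_(k <- s) f k x)%:E = \sum_(k <- s) \int[mu]_x (f k x)%:E)%E.
Proof.
move=> fi; elim: s => [|k s IH].
  by rewrite big_nil; under eq_integral do rewrite big_nil; rewrite integral0.
have si : mu.-integrable setT (EFin \o (fun x => \sum_(k <- s) f k x)).
  rewrite (_ : EFin \o _ = fun x => (\sum_(k <- s) (f k x)%:E)%E).
    by apply: integrable_sum => // k' _; exact: fi.
  by apply/funext => x /=; rewrite sumEFin.
rewrite big_cons -IH -(integralD_EFin measurableT (fi k) si).
by apply: eq_integral => x _ /=; rewrite big_cons.
Qed.

(** * Extension by zero of functions with compact support in an open set *)

Section extension_by_zero.
Context {R : realType} {n : nat}.
Variables (U K : set 'rV[R]_n).
Hypotheses (oU : open U) (cK : compact K) (KU : K `<=` U).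
Implicit Type f : 'rV[R]_n -> R.

Definition extend0 f x : R := if `[< U x >] then f x else 0.

Lemma extend0E f x : U x -> extend0 f x = f x.
Proof. by move=> Ux; rewrite /extend0 asboolT. Qed.

Variable f : 'rV[R]_n -> R.
Hypothesis fK : forall x, U x -> ~ K x -> f x = 0.

Lemma extend0_off x : ~ K x -> extend0 f x = 0.
Proof. by move=> Kx; rewrite /extend0; case: asboolP => // Ux; exact: fK. Qed.

Lemma open_setC_compact : open (~` K).
Proof.
by apply: closed_openC; apply: compact_closed.
Qed.

(** [U] and the complement of the compact set [K] are open and cover the space; the extension is [f]
    on one and 0 on the other. *)
Lemma Ck_extend0 k : Ck k U f -> Ck k setT (extend0 f).
Proof.
move=> Cf; apply: Ck_local => x _; have [Ux|nUx] := pselect (U x).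
  by exists U => //; apply: (Ck_eq oU _ Cf) => y Uy; rewrite extend0E.
exists (~` K); first by move=> Kx; apply: nUx; exact: KU.
by apply: (Ck_eq open_setC_compact _ (Ck_cst open_setC_compact k 0)) => y Ky; rewrite extend0_off.
Qed.

Lemma partial_extend0 j x : U x -> partial j (extend0 f) x = partial j f x.
Proof.
move=> Ux; apply: partial_near_eq.
by apply: filterS (open_nbhs_nbhs (conj oU Ux)) => y Uy; rewrite extend0E.
Qed.

Lemma partial_extend0_off j x : ~ K x -> partial j (extend0 f) x = 0.
Proof.
move=> Kx; rewrite -[RHS](partial_cst j 0 x); apply: partial_near_eq.
by apply: filterS (open_nbhs_nbhs (conj open_setC_compact Kx)) => y Ky; rewrite extend0_off.
Qed.

Lemma box_supported_extend0 L : (forall x, K x -> forall c, `|x 0 c| <= L) ->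
  box_supported L (extend0 f).
Proof.
by move=> KL x fx; apply: KL; apply: contra_notP (negP fx) => /extend0_off ->.
Qed.

End extension_by_zero.

Lemma compact_row_bounded (R : realType) n (K : set 'rV[R]_n) : compact K ->
  exists L : R, forall x, K x -> forall c, `|x 0 c| <= L.
Proof.
move=> /compact_bounded[L [_ KL]]; exists (L + 1) => x Kx c.
have := KL (L + 1); rewrite ltrDl ltr01 => /(_ isT x Kx); apply: le_trans.
by rewrite [leRHS]mx_normrE; exact: (le_bigmax _ _ (0, c)).
Qed.

(** * Integral estimates *)

Section integration.
Context {R : realType} {n : nat} {M : ptopologicalType} {A : @smooth_atlas R n M}.
Variable g : riemannian_metric A.
Local Notation borelM := (g_sigma_algebraType (@open M)).
Variable vol : {measure set borelM -> \bar R}.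
Hypothesis hvol : is_riemannian_volume g vol.
Hypotheses (hausM : hausdorff_space M) (compM : compact [set: M]).

Section local.
Variables (i : index A) (K : set 'rV[R]_n).
Hypotheses (cK : compact K) (KU : K `<=` cod (A i)).

Definition supported_in (f : M -> R) := forall p, ~ (param (A i) @` K) p -> f p = 0.

Lemma supported_in_param f x : supported_in f -> cod (A i) x -> ~ K x ->
  f (param (A i) x) = 0.
Proof.
move=> fK ix nKx; apply: fK => -[y Ky yx]; apply: nKx.
by rewrite -(paramK ix) -yx paramK//; exact: KU.
Qed.

Let oc := @open_cod _ _ _ (A i).

Lemma chart_density_integrable f : mfdCk A 0 f -> supported_in f ->
  (lebesgue_tuple n).-integrable setT
    (fun t => (chart_density g i f (row_of_tuple t))%:E) /\
  (\int[vol]_p (f p)%:E =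
   \int[lebesgue_tuple n]_t (chart_density g i f (row_of_tuple t))%:E)%E.
Proof.
move=> Cf fK; have [L KL] := compact_row_bounded cK.
pose h x := f (param (A i) x) * Num.sqrt (\det (g i x)).
have Ch : Ck 0 (cod (A i)) h by exact: (CkM oc (Cf i) (volume_density_Ck g 0 i)).
have hK x : cod (A i) x -> ~ K x -> h x = 0.
  by move=> ix Kx; rewrite /h (supported_in_param fK ix Kx) mul0r.
split.
  (* [chart_density g i f] unfolds to this extension by zero. *)
  apply: (@box_supported_integrable _ _ L (extend0 (cod (A i)) h)).
    by move=> x; exact: (Ck_continuous (Ck_extend0 oc cK KU hK Ch)).
  exact: (box_supported_extend0 hK).
apply: (integral_chart hvol); first exact: mfdCk_continuous Cf.
by move=> p ip; apply: fK => -[x Kx xp]; apply: ip; rewrite -xp; exact/param_dom/KU.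
Qed.

Variables (u a : M -> R).
Hypotheses (uC : mfdCk A 2 u) (u0 : forall p, 0 < u p).
Hypotheses (aC : mfdCk A 1 a) (a0 : forall p, 0 <= a p) (aK : supported_in a).

Local Notation phi := (fun q => ln (u q)).

(** The lower bound of [divergence_log_field], stripped of the density and read on M. It is linear
    in [a], so it can be summed over a partition of unity. *)
Definition log_divergence_bound p : R :=
  a p * u p * (2^-1 * mfd_grad_dot g phi phi p ^+ 2
    - (n%:R + 4) * hessian_sqnorm g phi p)
  + u p * mfd_grad_dot g phi phi p * mfd_grad_dot g phi a p.

Let phiC : mfdCk A 2 phi. Proof. exact: mfdCk_ln. Qed.
Let phiC1 : mfdCk A 1 phi. Proof. exact: mfdCk_le phiC. Qed.

Lemma mfdCk_log_divergence_bound : mfdCk A 0 log_divergence_bound.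
Proof.
have C0u : mfdCk A 0 u by exact: mfdCk_le uC.
have C0a : mfdCk A 0 a by exact: mfdCk_le aC.
have CN : mfdCk A 0 (mfd_grad_dot g phi phi) by exact: mfdCk_mfd_grad_dot.
have CS : mfdCk A 0 (hessian_sqnorm g phi) by exact: mfdCk_hessian_sqnorm.
have Ca : mfdCk A 0 (mfd_grad_dot g phi a) by exact: mfdCk_mfd_grad_dot.
apply: mfdCkD; last exact: mfdCkM (mfdCkM C0u CN) Ca.
apply: mfdCkM; first exact: mfdCkM.
apply: mfdCkD; first by apply: mfdCkM; [exact: mfdCk_cst|exact: mfdCkM].
have : mfdCk A 0 (fun p => -(n%:R + 4) * hessian_sqnorm g phi p).
  by apply: mfdCkM => //; exact: mfdCk_cst.
by under eq_fun do rewrite mulNr.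
Qed.

Lemma log_divergence_bound_supported : supported_in log_divergence_bound.
Proof.
move=> p nKp; rewrite /log_divergence_bound aK// !mul0r add0r.
rewrite (@mfd_grad_dot_near_cst _ _ _ _ _ phi a _ 0) ?mulr0//.
have oK : open (~` (param (A i) @` K)) by apply: closed_openC; exact: closed_param.
by apply: filterS (open_nbhs_nbhs (conj oK nKp)) => q nKq; exact: aK.
Qed.

Lemma integral_log_divergence_bound_le0 :
  (\int[vol]_p (log_divergence_bound p)%:E <= 0)%E.
Proof.
have [I1 ->] := chart_density_integrable mfdCk_log_divergence_bound
  log_divergence_bound_supported.
have [L KL] := compact_row_bounded cK.
pose ui := u \o param (A i); pose ai := a \o param (A i).
pose phii (y : 'rV[R]_n) := ln (ui y).
(* The components of a u N X times the volume density, so that the divergence becomes a plain sum of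
   partial derivatives. *)
pose v b (y : 'rV[R]_n) := ai y * ui y * grad_dot (g i) phii phii y *
  (gradient (g i) phii y 0 b * Num.sqrt (\det (g i y))).
have gpd x : cod (A i) x -> posdef (g i x) by exact: gram_posdef.
have C2p : Ck 2 (cod (A i)) phii := phiC i.
have C1u : Ck 1 (cod (A i)) ui := Ck_le (isT : (1 <= 2)%N) (uC i).
have Cv b : Ck 1 (cod (A i)) (v b).
  have C1 := Ck_grad_dot oc (gram_Ck g 1 i) gpd (isT : (1 <= 1)%N) C2p C2p.
  have C2 := Ck_gradient oc (gram_Ck g 1 i) gpd b (isT : (1 <= 1)%N) C2p.
  exact: (CkM oc (CkM oc (CkM oc (aC i) C1u) C1) (CkM oc C2 (volume_density_Ck g 1 i))).
have vK b x : cod (A i) x -> ~ K x -> v b x = 0.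
  by move=> ix Kx; rewrite /v /ai /= (supported_in_param aK ix Kx) !mul0r.
pose V b := extend0 (cod (A i)) (v b).
have CV b : Ck 1 setT (V b) := Ck_extend0 oc cK KU (vK b) (Cv b).
have VL b : box_supported L (V b) := box_supported_extend0 (vK b) KL.
have IV b : (lebesgue_tuple n).-integrable setT
    (EFin \o (fun t => partial b (V b) (row_of_tuple t))).
  apply: (@box_supported_integrable _ _ L (partial b (V b))).
    by move=> x; exact: (Ck_continuous (Ck_partial b (CV b))).
  exact: box_supported_partial.
have le_div x : chart_density g i log_divergence_bound x <=
    \sum_b partial b (V b) x.
  rewrite /chart_density; case: asboolP => [ix|nix]; last first.
    rewrite big1// => b _; apply: (partial_extend0_off cK (vK b)).
    by move=> Kx; apply: nix; exact: KU.
  rewrite mulrC /log_divergence_bound !mfd_grad_dot_param// hessian_sqnorm_param//.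
  under eq_bigr => b _ do rewrite (partial_extend0 oc (v b) b ix).
  exact: (divergence_log_field oc (gram_Ck g 1 i) gpd (uC i) (fun x _ => u0 _) (aC i) ix (a0 _)).
have IVs : (lebesgue_tuple n).-integrable setT
    (fun t => (\sum_b partial b (V b) (row_of_tuple t))%:E).
  rewrite (_ : (fun _ => _) = fun t => (\sum_b (partial b (V b) (row_of_tuple t))%:E)%E).
    by apply: integrable_sum => // b _; exact: IV.
  by apply/funext => t; rewrite sumEFin.
apply: (le_trans (le_integral measurableT I1 IVs _)).
  by move=> t _; rewrite lee_fin; exact: le_div.
rewrite (integral_EFin_sum _ IV) big1// => b _.
exact: (integral_partial b (CV b) (VL b)).
Qed.

End local.

(** A partition of unity splits the constant 1 into finitely many functions, each of which has a
    finite integral because it is compactly supported in a chart. *)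
Lemma volume_lty : (vol setT < +oo)%E.
Proof.
have [s [a [K KP [a0 aC aK a1]]]] := partition_of_unity A hausM compM.
have C0 k : mfdCk A 0 (a k) by exact: mfdCk_le (aC k).
rewrite -[vol setT]mul1e -(integral_cst vol measurableT).
rewrite (eq_integral (fun p : borelM => (\sum_(k <- s) (a k p)%:E)%E)); last first.
  by move=> p _; rewrite sumEFin a1.
rewrite ge0_integral_sum//; last 2 first.
- move=> k; apply/measurable_EFinP.
  exact: (borel_continuous (mfdCk_continuous (C0 k))).
- by move=> k p _; rewrite lee_fin.
apply: lte_sum_pinfty => k _; have [cK KU] := KP k.
have [I1 ->] := chart_density_integrable cK KU (C0 k) (aK k).
by have := integrable_fin_num measurableT I1; rewrite fin_numE ltey => /andP[].
Qed.

Lemma continuous_integrable (f : M -> R) : continuous f ->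
  vol.-integrable setT (EFin \o f).
Proof.
move=> cf; apply: measurable_bounded_integrable => //.
- exact: volume_lty.
- exact: borel_continuous.
have := compact_bounded (continuous_compact (continuous_subspaceT cf) compM).
by move=> [L [Lr HL]]; exists L; split => // y /HL H p _; apply: H; exists p.
Qed.

Lemma integral_hessian_sqrt_le (u : M -> R) : mfdCk A 2 u -> (forall p, 0 < u p) ->
  (\int[vol]_p (hessian_sqnorm g (fun q => Num.sqrt (u q)) p)%:E <=
   (2^-1 + 4^-1 * (n%:R + 4))%:E *
   \int[vol]_p (u p * hessian_sqnorm g (fun q => ln (u q)) p)%:E)%E.
Proof.
move=> uC u0; pose phi q := ln (u q); pose S := hessian_sqnorm g phi.
pose N := mfd_grad_dot g phi phi; pose c : R := n%:R + 4.
have phiC : mfdCk A 2 phi by exact: mfdCk_ln.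
have [s [a [K KP [a0 aC aK a1]]]] := partition_of_unity A hausM compM.
pose T k := log_divergence_bound u (a k).
have TC k : mfdCk A 0 (T k) by exact: mfdCk_log_divergence_bound.
have sumT p : \sum_(k <- s) T k p = u p * (2^-1 * N p ^+ 2 - c * S p).
  rewrite big_split /= -mulr_suml -mulr_suml -mulr_sumr a1 -mfd_grad_dot_sum//.
  rewrite (@mfd_grad_dot_near_cst _ _ _ _ _ _ (fun q => \sum_(k <- s) a k q) _ 1) ?mulr0 ?addr0 ?mul1r//.
  exact: nearW.
have intT k : vol.-integrable setT (EFin \o T k).
  exact: continuous_integrable (mfdCk_continuous (TC k)).
have C0u : mfdCk A 0 u by exact: mfdCk_le uC.
have C0S : mfdCk A 0 S by exact: mfdCk_hessian_sqnorm.
have intS : vol.-integrable setT (EFin \o (fun p => u p * S p)).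
  exact: continuous_integrable (mfdCk_continuous (mfdCkM C0u C0S)).
have intST : vol.-integrable setT (EFin \o (fun p => \sum_(k <- s) T k p)).
  exact: continuous_integrable (mfdCk_continuous (mfdCk_sum s TC)).
have intZ r (f : M -> R) : vol.-integrable setT (EFin \o f) ->
    vol.-integrable setT (EFin \o (fun p => r * f p)).
  by move=> fi; apply: (integrableZl measurableT r fi).
(* By [sumT], a quarter of the sum of the [T k] is u N^2 / 8 - c u S / 4. Added to (1/2 + c/4) u S
   it reproduces exactly the bound of [hessian_sqnorm_sqrt_le], so u N^2 is never integrated by
   itself. *)
apply: (@le_trans _ _ (\int[vol]_p ((2^-1 + 4^-1 * c) * (u p * S p)
    + 4^-1 * \sum_(k <- s) T k p)%:E)%E).
  apply: le_integral => //.
  - apply: (continuous_integrable (mfdCk_continuous _ (f := hessian_sqnorm g _))).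
    exact: (mfdCk_hessian_sqnorm (mfdCk_sqrt uC u0)).
  - have := integrableD measurableT (intZ (2^-1 + 4^-1 * c) _ intS) (intZ 4^-1 _ intST).
    by apply: eq_integrable => // p _.
  move=> p _; rewrite lee_fin sumT.
  apply: (le_trans (hessian_sqnorm_sqrt_le g uC u0 p)).
  rewrite -/phi -/(S p) -/(N p) le_eqVlt; apply/orP; left; apply/eqP.
  by field.
rewrite (integralD_EFin measurableT (intZ _ _ intS) (intZ _ _ intST)).
rewrite -[leRHS]adde0; apply: leeD.
  by rewrite [leLHS](integralZl measurableT intS).
rewrite [leLHS](integralZl measurableT intST); apply: mule_ge0_le0; first by rewrite lee_fin.
rewrite (integral_EFin_sum s intT); apply: sume_le0 => k _.
have [cK KU] := KP k.
exact: (integral_log_divergence_bound_le0 cK KU uC u0 (aC k) (a0 k) (aK k)).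
Qed.

End integration.

Theorem theorem1 (R : realType) (n : nat) (M : ptopologicalType)
  (hausM : hausdorff_space M) (compM : compact [set: M])
  (A : @smooth_atlas R n M) (g : riemannian_metric A)
  (vol : {measure set (g_sigma_algebraType (@open M)) -> \bar R})
  (hvol : is_riemannian_volume g vol) :
  exists C : R, 0 < C /\
    forall u : M -> R, smooth A u -> (forall p, 0 < u p) ->
      (\int[vol]_p (hessian_sqnorm g (fun q => Num.sqrt (u q)) p)%:E <=
       C%:E *
       \int[vol]_p (u p * hessian_sqnorm g (fun q => ln (u q)) p)%:E)%E.
Proof.
exists (2^-1 + 4^-1 * (n%:R + 4)); split.
  by rewrite addr_gt0// mulr_gt0// ltr_wpDl.
move=> u uC u0.
exact: (integral_hessian_sqrt_le hvol hausM compM (smooth_mfdCk 2 uC) u0).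
Qed.
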